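(* Let $\Bbbk$ be a field, let $q\in\Bbbk^*$ be not a root of unity, let $n\ge 1$, and let $\alpha_1,\ldots,\alpha_n,\tilde\alpha_1,\ldots,\tilde\alpha_n\in\Bbbk^*$. Then every $\Bbbk$-algebra homomorphism $$\mathscr{A}_{\alpha_1,q}\otimes\cdots\otimes\mathscr{A}_{\alpha_n,q}\longrightarrow \mathscr{A}_{\tilde\alpha_1,q}\otimes\cdots\otimes\mathscr{A}_{\tilde\alpha_n,q}$$ (tensor products over $\Bbbk$) is invertible.
   Context: For $\alpha,q\in\Bbbk^*$, $\mathscr{A}_{\alpha,q}$ denotes the $\Bbbk$-algebra generated by $e_1,e_2,e_3$ subject to the relations $e_1e_3=q^{-1}e_3e_1$, $e_2e_3=qe_3e_2+\alpha$, $e_2e_1=q^{-1}e_1e_2-q^{-1}e_3$, and $e_3^2+(q^2-1)e_3e_1e_2+\alpha q(q+1)e_1=0$. *)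

(* Defs.v *)
From HB Require Import structures.
From mathcomp Require Import all_boot all_order all_algebra.
Set Implicit Arguments. Unset Strict Implicit. Unset Printing Implicit Defensive.
Import GRing.Theory.
Local Open Scope ring_scope.

Definition is_alg_hom (K : fieldType) (A B : algType K) (f : A -> B) : Prop :=
  [/\ forall (a : K) (x y : A), f (a *: x + y) = a *: f x + f y,
      f 1 = 1 &
      forall x y : A, f (x * y) = f x * f y].

Definition A_rels (K : fieldType) (B : algType K) (alpha q : K) (e1 e2 e3 : B) : Prop :=
  [/\ e1 * e3 = q^-1 *: (e3 * e1),
      e2 * e3 = q *: (e3 * e2) + alpha%:A,
      e2 * e1 = q^-1 *: (e1 * e2) - q^-1 *: e3 &
      e3 * e3 + (q ^+ 2 - 1) *: (e3 * e1 * e2) + (alpha * q * (q + 1)) *: e1 = 0].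

Definition gen (K : fieldType) (B : algType K) (n : nat) (e1 e2 e3 : 'I_n -> B)
    (i : 'I_n) (s : 'I_3) : B :=
  nth 0 [:: e1 i; e2 i; e3 i] s.

Definition tensorA_rels (K : fieldType) (B : algType K) (n : nat)
    (alpha : 'I_n -> K) (q : K) (e1 e2 e3 : 'I_n -> B) : Prop :=
  (forall i, A_rels (alpha i) q (e1 i) (e2 i) (e3 i)) /\
  (forall i j : 'I_n, i != j -> forall s t : 'I_3,
      gen e1 e2 e3 i s * gen e1 e2 e3 j t = gen e1 e2 e3 j t * gen e1 e2 e3 i s).

(* T, with the elements e1 e2 e3, is (a model of) the k-algebra presented by
   the generators e1 i, e2 i, e3 i (i < n) and the relations tensorA_rels,
   i.e. A_{alpha_1,q} (x)_k ... (x)_k A_{alpha_n,q}: defined by its universal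
   property. *)
Definition is_tensorA (K : fieldType) (n : nat) (alpha : 'I_n -> K) (q : K)
    (T : algType K) (e1 e2 e3 : 'I_n -> T) : Prop :=
  tensorA_rels alpha q e1 e2 e3 /\
  forall (B : algType K) (b1 b2 b3 : 'I_n -> B),
    tensorA_rels alpha q b1 b2 b3 ->
    exists f : T -> B,
      [/\ is_alg_hom f,
          (forall i, [/\ f (e1 i) = b1 i, f (e2 i) = b2 i & f (e3 i) = b3 i]) &
          forall g : T -> B, is_alg_hom g ->
            (forall i, [/\ g (e1 i) = b1 i, g (e2 i) = b2 i & g (e3 i) = b3 i]) ->
            g =1 f].

(* Main.v *)
(** Put y = e2, x = (q - 1) e3 / alpha and h = x y + 1. Then h is invertible, e1 is a multiple
    of h^-1 x^2, and A_{alpha,q} becomes the localized quantum Weyl algebra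
    h x = q x h, y h = q h y, x y = h - 1, y x = q h - 1, whatever alpha is. The tensor product
    has the basis h^m v_a with m, a in Z^n, where v_a is a product of powers of the x_j (a_j > 0)
    and y_j (a_j < 0); the independence of this basis holds in every nonzero algebra containing
    such elements, since q is not a root of unity, and so every homomorphism is injective.

    For the lexicographic order on Z^n, comparing extreme terms shows that the units are the
    monomials c h^m. Hence a homomorphism sends h_i to c_i h^{M_i}, and x_i, y_i to eigenvectors
    p v_a, r v_{-a} for conjugation by the images of the h_k. If a_j <> 0, the product
    c_i h^{M_i} - 1 of these images is divisible by some k h_j - 1, which is only possible if M_i
    is supported at j. So M_i = +-unit vector at j, a likewise, p and r are units, and x_j, y_j
    and h_j^{+-1} are in the image. *)
Require Import Defs.
From HB Require Import structures.
From mathcomp Require Import all_boot all_order all_algebra.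
From mathcomp Require Import boolp ring.
Import Order.TTheory GRing.Theory Num.Theory.
Local Open Scope ring_scope.

Set Implicit Arguments.
Unset Strict Implicit.
Unset Printing Implicit Defensive.

(** * Subalgebras, algebra homomorphisms, and generation of the tensor product *)

Section Subalgebra.
Variables (K : fieldType) (A : algType K) (P : A -> Prop).
Hypothesis P1 : P 1.
Hypothesis P_lin : forall c x y, P x -> P y -> P (c *: x + y).
Hypothesis P_mul : forall x y, P x -> P y -> P (x * y).

(** Subtypes are carved out by boolean predicates, so [P] is reflected classically. *)
Definition subalg_mem := [pred x : A | `[< P x >]].

Lemma subalg_mem_closed : GRing.subalg_closed subalg_mem.
Proof.
split=> [|c x y|x y]; rewrite !inE; first exact/asboolP.
- by move=> /asboolP Px /asboolP Py; apply/asboolP/P_lin.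
- by move=> /asboolP Px /asboolP Py; apply/asboolP/P_mul.
Qed.

HB.instance Definition _ := GRing.isSubalgClosed.Build K A subalg_mem subalg_mem_closed.

Record subalg := Subalg {subalg_val :> A; _ : subalg_mem subalg_val}.
HB.instance Definition _ := [isSub for subalg_val].
HB.instance Definition _ := [Choice of subalg by <:].
HB.instance Definition _ := [SubChoice_isSubAlgebra of subalg by <:].

(** The universal property in [is_tensorA] ranges over algebras, not subsets; this packages [P] as
    an algebra with an embedding. *)
Lemma subalg_algType : 
  exists (B : algType K) (v : B -> A), [/\ is_alg_hom v, injective v & forall x, P x <-> exists b, v b = x].
Proof.
exists subalg, val; split=> [||x].
- by split=> *; rewrite ?linearP ?rmorph1 ?rmorphM.
- exact: val_inj.
- split=> [Px|[b <-]]; last by case: b => b /= /asboolP.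
  have Sx : subalg_mem x by exact/asboolP.
  by exists (Subalg Sx).
Qed.

End Subalgebra.

Section AlgHom.
Variables (K : fieldType) (A B : algType K) (f : A -> B).
Hypothesis fP : is_alg_hom f.

Lemma alg_hom0 : f 0 = 0.
Proof.
case: fP => lin _ _; have := lin (-1) 0 0.
by rewrite scaler0 addr0 scaleN1r addNr.
Qed.
Lemma alg_homD x y : f (x + y) = f x + f y.
Proof. by case: fP => lin _ _; have := lin 1 x y; rewrite !scale1r. Qed.
Lemma alg_homZ c x : f (c *: x) = c *: f x.
Proof. by case: fP => lin _ _; have := lin c x 0; rewrite alg_hom0 !addr0. Qed.
Lemma alg_homB x y : f (x - y) = f x - f y.
Proof. by rewrite -!scaleN1r alg_homD alg_homZ. Qed.
Lemma alg_hom1 : f 1 = 1. Proof. by case: fP. Qed.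
Lemma alg_homM x y : f (x * y) = f x * f y. Proof. by case: fP. Qed.
Lemma alg_hom_sum (I : Type) (s : seq I) (F : I -> A) :
  f (\sum_(i <- s) F i) = \sum_(i <- s) f (F i).
Proof. exact: (big_morph f alg_homD alg_hom0). Qed.
Lemma alg_hom_prod (I : Type) (s : seq I) (F : I -> A) :
  f (\prod_(i <- s) F i) = \prod_(i <- s) f (F i).
Proof. exact: (big_morph f alg_homM alg_hom1). Qed.
Lemma alg_homX x m : f (x ^+ m) = f x ^+ m.
Proof. by elim: m => [|m IH]; rewrite ?expr0 ?alg_hom1 // !exprS alg_homM IH. Qed.
End AlgHom.

Lemma alg_hom_comp (K : fieldType) (A B C : algType K) (f : A -> B) (g : B -> C) :
  is_alg_hom f -> is_alg_hom g -> is_alg_hom (g \o f).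
Proof.
by move=> [fl f1 fm] [gl g1 gm]; split=> *; rewrite /= ?fl ?f1 ?fm ?gl ?g1 ?gm.
Qed.

Lemma tensorA_rels_preim (K : fieldType) (A B : algType K) (v : A -> B) n
    (alpha : 'I_n -> K) q (a1 a2 a3 : 'I_n -> A) :
  is_alg_hom v -> injective v ->
  tensorA_rels alpha q (v \o a1) (v \o a2) (v \o a3) -> tensorA_rels alpha q a1 a2 a3.
Proof.
move=> vP vI [rel com]; split=> [i|i j ij s t].
- case: (rel i) => /= r1 r2 r3 r4.
  by split; apply: vI; rewrite !(alg_homM vP, alg_homB vP, alg_homD vP, alg_homZ vP, alg_hom1 vP, alg_hom0 vP).
- have gE k u : v (gen a1 a2 a3 k u) = gen (v \o a1) (v \o a2) (v \o a3) k u.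
    by rewrite /gen; case: u => -[|[|[|]]].
  by apply: vI; rewrite !(alg_homM vP) !gE com.
Qed.

(** Generation is recovered from uniqueness in the universal property: the generators lift to the
    subalgebra cut out by [P], and the induced map followed by the inclusion fixes them, hence is
    the identity. *)
Lemma tensorA_ind (K : fieldType) n (alpha : 'I_n -> K) q (T : algType K)
    (e1 e2 e3 : 'I_n -> T) (P : T -> Prop) :
  is_tensorA alpha q e1 e2 e3 ->
  P 1 -> (forall c x y, P x -> P y -> P (c *: x + y)) ->
  (forall x y, P x -> P y -> P (x * y)) ->
  (forall i, [/\ P (e1 i), P (e2 i) & P (e3 i)]) -> forall t, P t.
Proof.
move=> [rel univ] P1 Pl Pm Pe.
have [S [v [vP vI vE]]] := subalg_algType P1 Pl Pm.
have lift e : (forall i : 'I_n, P (e i)) -> {b : 'I_n -> S | forall i, v (b i) = e i}.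
  move=> He; have H i : exists b, v b = e i by exact/vE.
  by exists (fun i => projT1 (cid (H i))) => i; case: (cid _).
have [b1 b1E] : {b : 'I_n -> S | forall i, v (b i) = e1 i} by apply: lift => i; case: (Pe i).
have [b2 b2E] : {b : 'I_n -> S | forall i, v (b i) = e2 i} by apply: lift => i; case: (Pe i).
have [b3 b3E] : {b : 'I_n -> S | forall i, v (b i) = e3 i} by apply: lift => i; case: (Pe i).
have relb : tensorA_rels alpha q b1 b2 b3.
  apply: (tensorA_rels_preim vP vI).
  have -> : v \o b1 = e1 by exact: funext.
  have -> : v \o b2 = e2 by exact: funext.
  by have -> : v \o b3 = e3 by exact: funext.
have [g [gP gE _]] := univ _ _ _ _ relb.
(* [h] only mediates: uniqueness for the tuple [e1], [e2], [e3] itself identifies both [id] and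
   [v \o g] with it. *)
have [h [_ _ huniq]] := univ _ _ _ _ rel.
have idE : id =1 h by apply: huniq => //; split.
have vgE : v \o g =1 h.
  apply: huniq => [|i /=]; last by case: (gE i) => -> -> ->; rewrite b1E b2E b3E.
  exact: alg_hom_comp.
by move=> t; apply/vE; exists (g t); rewrite -[LHS]/((v \o g) t) vgE -idE.
Qed.

(** * Passage to quantum Weyl algebras *)

(* Up to rescaling the generators, A_{alpha,q} is the quantum Weyl algebra on x, y with the
   normal element h = x y + 1 inverted (hi is the inverse); alpha disappears. *)
Record qweyl (K : fieldType) (q : K) (B : algType K) n
    (h hi x y : 'I_n -> B) : Prop := QWeyl {
  qw_hV : forall i, h i * hi i = 1;
  qw_Vh : forall i, hi i * h i = 1;
  qw_hx : forall i, h i * x i = q *: (x i * h i);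
  qw_yh : forall i, y i * h i = q *: (h i * y i);
  qw_xy : forall i, x i * y i = h i - 1;
  qw_yx : forall i, y i * x i = q *: h i - 1;
  qw_hh : forall i j, i != j -> GRing.comm (h i) (h j);
  qw_hxC : forall i j, i != j -> GRing.comm (h i) (x j);
  qw_hyC : forall i j, i != j -> GRing.comm (h i) (y j);
  qw_xxC : forall i j, i != j -> GRing.comm (x i) (x j);
  qw_xyC : forall i j, i != j -> GRing.comm (x i) (y j);
  qw_yyC : forall i j, i != j -> GRing.comm (y i) (y j)
}.

Lemma commr_scale (K : fieldType) (B : algType K) c (u v : B) :
  GRing.comm u v -> GRing.comm u (c *: v).
Proof. by rewrite /GRing.comm -scalerAr -scalerAl => ->. Qed.

(* The formula for hi comes from h e1 = k x^2 and
   x^2 y^2 = q^-1 h^2 - (1 + q^-1) h + 1, where y = e2. *)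
Lemma qweyl_of_A_rels (K : fieldType) (q alpha : K) (B : algType K) (e1 e2 e3 : B) :
  q != 0 -> q != 1 -> q ^+ 2 != 1 -> alpha != 0 -> A_rels alpha q e1 e2 e3 ->
  let x := ((q - 1) / alpha) *: e3 in
  let h := x * e2 + 1 in
  let k := - (q * alpha / ((q - 1) * (q ^+ 2 - 1))) in
  let hi := k^-1 *: (e1 * e2 ^+ 2) - q^-1 *: h + (1 + q^-1) *: 1 in
  [/\ h * x = q *: (x * h), e2 * h = q *: (h * e2) & e2 * x = q *: h - 1] /\
  [/\ h * hi = 1, hi * h = 1 & e1 = k *: (hi * x ^+ 2)].
Proof.
move=> q0 q1 qq1 a0 [r13 r23 r21 r4] x h k hi.
have q10 : q - 1 != 0 by rewrite subr_eq0.
have qq10 : q ^+ 2 - 1 != 0 by rewrite subr_eq0.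
have q20 : q + 1 != 0.
  by apply: contraNneq qq10 => H; rewrite -(expr1n K 2) subr_sqr H mulr0.
have k0 : k != 0 by rewrite oppr_eq0 !mulf_neq0 ?invr_neq0 ?mulf_neq0.
pose l := alpha / (q - 1).
have xE : x = ((q - 1) / alpha) *: e3 by [].
have e3E : e3 = l *: x by rewrite /x scalerA /l mulrA divfK // divff // scale1r.
have hE : h = x * e2 + 1 by [].
clearbody h x.
(* The factor in [x] turns the constant [alpha] into q - 1, and q x y + (q - 1) = q h - 1. *)
have yx : e2 * x = q *: h - 1.
  rewrite hE scalerDr -addrA xE -scalerAl -scalerAr r23 scalerDr !scalerA [_ * q]mulrC.
  by congr (_ + _); rewrite -[X in _ = _ - X]scale1r -scalerBl divfK.
have hx : h * x = q *: (x * h).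
  by rewrite {1}hE mulrDl mul1r -mulrA yx mulrBr mulr1 subrK scalerAr.
have yh : e2 * h = q *: (h * e2).
  by rewrite {1}hE mulrDr mulr1 mulrA yx mulrBl mul1r subrK scalerAl.
have e1x : e1 * x = q^-1 *: (x * e1).
  by rewrite xE -scalerAr -scalerAl r13 !scalerA mulrC.
(* The fourth relation, solved for the product x e1 y. *)
have xe1y : x * e1 * e2 = - q *: e1 + (q^-1 * k) *: x ^+ 2.
  have := r4; rewrite e3E -scalerAl -scalerAr -!scalerAl !scalerA => H.
  have c0 : (q ^+ 2 - 1) * l != 0 by rewrite !mulf_neq0 // invr_neq0.
  move/eqP: H; rewrite addrAC addr_eq0 => /eqP H; apply: (scalerI c0).
  rewrite -[LHS]opprK -H -expr2 opprD addrC scalerDr !scalerA -!scaleNr.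
  by congr (_ *: _ + _ *: _); rewrite /k /l; field; rewrite ?q0 ?q10 ?qq10 ?a0.
(* The third relation and [xe1y] make the two terms in [e1] cancel; what is left of x^2 has
   coefficient [k]. *)
have he1 : h * e1 = k *: x ^+ 2.
  rewrite hE mulrDl mul1r -mulrA r21 e3E mulrBr -!scalerAr mulrA xe1y.
  rewrite scalerDr !scalerA mulrN mulVf // scaleN1r addrAC [- e1 + _]addrC addrNK.
  rewrite -expr2 -scalerBl; congr (_ *: _); rewrite /k /l; field.
  by rewrite q0 q10 qq10.
have e1h : e1 * h = (q ^- 2 * k) *: x ^+ 2.
  rewrite hE mulrDr mulr1 mulrA e1x -!scalerAl xe1y scalerDr !scalerA mulrN mulVf //.
  rewrite scaleN1r [- e1 + _]addrC addrNK; congr (_ *: _); field; exact: q0.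
have xxyy : x ^+ 2 * e2 ^+ 2 = q^-1 *: (h * h) - (1 + q^-1) *: h + 1.
  have xy : x * e2 = h - 1 by rewrite hE addrK.
  have xh : x * h = q^-1 *: (h * x) by rewrite hx scalerA mulVf // scale1r.
  rewrite !expr2 -mulrA [x * (e2 * e2)]mulrA xy mulrA mulrBr xh mulr1 mulrBl -scalerAl.
  rewrite -mulrA xy mulrBr mulr1 scalerBr scalerDl scale1r !opprD opprK !addrA.
  by rewrite [_ - h - _ *: h]addrAC.
have cancel (a b c : B) : a - b + c - a + b = c.
  by rewrite -addrA [- a + b]addrC -[b - a]opprB addrAC addrN add0r.
have hih : hi * h = 1.
  have yyh : e2 ^+ 2 * h = q ^+ 2 *: (h * e2 ^+ 2).
    by rewrite !expr2 -mulrA yh -scalerAr mulrA yh -scalerAl scalerA mulrA.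
  rewrite !mulrDl mulNr -!scalerAl mul1r -mulrA yyh -scalerAr mulrA e1h -scalerAl !scalerA.
  rewrite (_ : k^-1 * q ^+ 2 * (q ^- 2 * k) = 1).
    by rewrite scale1r xxyy; exact: cancel.
  by rewrite mulrA mulfK ?expf_neq0 // mulVf.
split=> //; split=> //.
- rewrite !mulrDr mulrN -!scalerAr mulr1 mulrA he1 -scalerAl scalerA mulVf // scale1r xxyy.
  exact: cancel.
- by rewrite scalerAr -he1 mulrA hih mul1r.
Qed.

(** Different indices commute because h_i and x_i are polynomials in the generators of the i-th
    factor. The last two clauses allow [e1] and [e3] to be recovered from [hi] and [x]. *)
Lemma tensorA_qweyl (K : fieldType) (q : K) (B : algType K) n (alpha : 'I_n -> K)
    (e1 e2 e3 : 'I_n -> B) :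
  q != 0 -> q != 1 -> q ^+ 2 != 1 -> (forall i, alpha i != 0) ->
  tensorA_rels alpha q e1 e2 e3 ->
  exists h hi x : 'I_n -> B, exists k l : 'I_n -> K,
    [/\ qweyl q h hi x e2, forall i, e1 i = k i *: (hi i * x i ^+ 2)
      & forall i, e3 i = l i *: x i].
Proof.
move=> q0 q1 qq1 a0 [rel com].
have Q i := qweyl_of_A_rels q0 q1 qq1 (a0 i) (rel i).
pose x i := ((q - 1) / alpha i) *: e3 i.
pose h i := x i * e2 i + 1.
(* [gen] counts from 0: index 1 selects [e2], index 2 selects [e3]. *)
have c22 i j : i != j -> GRing.comm (e2 i) (e2 j) by move=> ij; exact: (com i j ij 1 1).
have c33 i j : i != j -> GRing.comm (e3 i) (e3 j) by move=> ij; exact: (com i j ij 2%:R 2%:R).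
have c32 i j : i != j -> GRing.comm (e3 i) (e2 j) by move=> ij; exact: (com i j ij 2%:R 1).
have cxx i j : i != j -> GRing.comm (x i) (x j).
  by move=> ij; apply: commr_scale; apply/commr_sym/commr_scale/commr_sym/c33.
have cxy i j : i != j -> GRing.comm (x i) (e2 j).
  by move=> ij; apply/commr_sym/commr_scale/commr_sym/c32.
have chx i j : i != j -> GRing.comm (h i) (x j).
  move=> ij; apply/commr_sym/commrD; last exact: commr1.
  by apply: commrM; [apply: cxx | apply: cxy]; rewrite eq_sym.
have chy i j : i != j -> GRing.comm (h i) (e2 j).
  move=> ij; apply/commr_sym/commrD; last exact: commr1.
  by apply: commrM; [apply/commr_sym/cxy | apply: c22; rewrite eq_sym].
pose k i := - (q * alpha i / ((q - 1) * (q ^+ 2 - 1))).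
pose hi i := (k i)^-1 *: (e1 i * e2 i ^+ 2) - q^-1 *: h i + (1 + q^-1) *: 1.
exists h, hi, x, k, (fun i => alpha i / (q - 1)); split=> [|i|i].
- split=> // [i|i|i|i|i|i|i j ij].
  + by have [_ []] := Q i.
  + by have [_ []] := Q i.
  + by have [[]] := Q i.
  + by have [[]] := Q i.
  + by rewrite /h addrK.
  + by have [[]] := Q i.
  + by apply: commrD; [apply: commrM; [apply: chx | apply: chy] | exact: commr1].
- by have [_ []] := Q i.
- by rewrite scalerA mulrA divfK ?subr_eq0 // divff // scale1r.
Qed.

(** * Algebras graded by an ordered group *)

Definition ordered_group (G : zmodType) (lt : G -> G -> Prop) : Prop :=
  [/\ forall a, ~ lt a a, forall a b c, lt a b -> lt b c -> lt a c,
      forall a b c, lt a b -> lt (a + c) (b + c) & forall a b, a != b -> lt a b \/ lt b a].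

(** Reversing the order turns greatest degrees into least ones, so extreme terms are treated only
    once. *)
Lemma ordered_group_flip (G : zmodType) (lt : G -> G -> Prop) :
  ordered_group lt -> ordered_group (fun a b => lt b a).
Proof.
move=> [irr tr add tot]; split=> // [a b c ab bc|a b c|a b /tot]; first exact: tr ab.
  exact: add.
by case; [right | left].
Qed.

Definition lex_lt n (a b : 'rV[int]_n) : Prop :=
  exists i, a 0 i < b 0 i /\ forall j : 'I_n, (j < i)%N -> a 0 j = b 0 j.

Lemma lex_ordered n : ordered_group (@lex_lt n).
Proof.
split=> [a [i []]|a b c [i [abi abj]] [k [bck bcj]]|a b c [i [abi abj]]|a b nab].
- by rewrite ltxx.
- case: (ltngtP i k) => [ik|ki|/val_inj ik].
  + exists i; split=> [|j ji]; first by rewrite -bcj.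
    by rewrite abj // bcj // (ltn_trans ji).
  + exists k; split=> [|j jk]; first by rewrite abj.
    by rewrite abj ?bcj // (ltn_trans jk).
  + move: abi abj; rewrite ik => abk abj; exists k; split=> [|j jk]; first exact: lt_trans bck.
    by rewrite abj ?bcj.
- by exists i; split=> [|j ji]; rewrite !mxE ?ltrD2r // abj.
- have [i0 ai0] : exists i, a 0 i != b 0 i.
    apply/existsP; apply: contraR nab; rewrite negb_exists => /forallP H.
    by apply/eqP/rowP => i; apply/eqP/negPn/H.
  case: (arg_minnP (fun i : 'I_n => i : nat) (i0 := i0) (P := fun i => a 0 i != b 0 i)) => // i nabi mini.
  have eqj (j : 'I_n) : (j < i)%N -> a 0 j = b 0 j.
    by move=> ji; apply/eqP; apply: contraTT ji => /mini; rewrite -leqNgt.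
  case: (ltrgtP (a 0 i) (b 0 i)) nabi => // H _; [left|right]; exists i; split=> // j /eqj //.
Qed.

Section Graded.
Variables (T : pzRingType) (G : zmodType) (C : G -> T -> Prop).
Hypothesis C0 : forall g, C g 0.
Hypothesis CD : forall g x y, C g x -> C g y -> C g (x + y).
Hypothesis CN : forall g x, C g x -> C g (- x).
Hypothesis CM : forall g g' x y, C g x -> C g' y -> C (g + g') (x * y).

(** The list may repeat degrees. This is instantiated twice: for the exponents of the h-monomials
    ([inR]) and for the weights ([graded]). *)
Definition hsum (t : T) : Prop :=
  exists2 L : seq (G * T), (forall p, p \in L -> C p.1 p.2) & t = \sum_(p <- L) p.2.

Lemma hsum_homog g t : C g t -> hsum t.
Proof.
by move=> Ct; exists [:: (g, t)]; rewrite ?big_seq1 // => p; rewrite inE => /eqP ->.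
Qed.

Lemma hsumD t t' : hsum t -> hsum t' -> hsum (t + t').
Proof.
move=> [L LC ->] [L' LC' ->]; exists (L ++ L'); last by rewrite big_cat.
by move=> p; rewrite mem_cat => /orP[/LC|/LC'].
Qed.

Lemma C_sum (I : Type) (s : seq I) (P : pred I) (F : I -> T) g :
  (forall i, P i -> C g (F i)) -> C g (\sum_(i <- s | P i) F i).
Proof. by move=> H; apply: (big_ind (C g)) => // x y; apply: CD. Qed.

Lemma hsum_sum (I : Type) (s : seq I) (F : I -> T) :
  (forall i, hsum (F i)) -> hsum (\sum_(i <- s) F i).
Proof.
by move=> H; apply: (big_ind hsum) => //; [apply: (@hsum_homog 0) | exact: hsumD].
Qed.

Lemma hsumM t t' : hsum t -> hsum t' -> hsum (t * t').
Proof.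
move=> [L LC ->] [L' LC' ->]; rewrite big_distrl big_seq /=.
apply: (big_ind hsum) => [||p /LC Cp]; [exact: (@hsum_homog 0) | exact: hsumD |].
rewrite big_distrr big_seq /=.
apply: (big_ind hsum) => [||p' /LC' Cp']; [exact: (@hsum_homog 0) | exact: hsumD |].
by apply: (@hsum_homog (p.1 + p'.1)); apply: CM.
Qed.

Lemma sum_by_degree (I : Type) (L : seq I) (d : I -> G) (F : I -> T) (s : seq G) :
  uniq s -> all (fun i => d i \in s) L ->
  \sum_(i <- L) F i = \sum_(g <- s) \sum_(i <- L | d i == g) F i.
Proof.
move=> us; elim: L => [|i L IH] /=; first by rewrite big_nil big1 // => g; rewrite big_nil.
move=> /andP[is_ /IH Ls]; rewrite big_cons Ls.
under [RHS]eq_bigr do rewrite big_cons.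
rewrite (big_rem (d i)) //= [in RHS](big_rem (d i)) //= eqxx addrA; congr (_ + _).
rewrite (rem_filter _ us) !big_filter; apply: eq_bigr => g /=.
by rewrite eq_sym => /negPf ->.
Qed.

(** Terms of equal degree are added up and the degrees whose sum vanishes are dropped. *)
Lemma hsum_normal t : hsum t -> exists s (u : G -> T),
  [/\ uniq s, forall g, C g (u g), forall g, g \in s -> u g != 0 & t = \sum_(g <- s) u g].
Proof.
move=> [L LC ->]; pose u g := \sum_(p <- L | p.1 == g) p.2.
have uC g : C g (u g).
  by rewrite /u big_seq_cond; apply: C_sum => p /andP[/LC Cp /eqP <-].
exists [seq g <- undup (map fst L) | u g != 0], u; split=> //.
- by rewrite filter_uniq ?undup_uniq.
- by move=> g; rewrite mem_filter => /andP[].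
- rewrite (@sum_by_degree _ L fst _ (undup (map fst L))) ?undup_uniq //; last first.
    by apply/allP => p pL; rewrite mem_undup map_f.
  rewrite big_filter [LHS](bigID (fun g => u g == 0)) /= big1 ?add0r //.
  by move=> g /eqP.
Qed.

Hypothesis direct : forall s (u : G -> T), uniq s -> (forall g, C g (u g)) ->
  \sum_(g <- s) u g = 0 -> forall g, g \in s -> u g = 0.
Hypothesis C_nz : forall g g' x y, C g x -> C g' y -> x != 0 -> y != 0 -> x * y != 0.

Section Extremal.
Variable lt : G -> G -> Prop.
Hypothesis ltP : ordered_group lt.

Lemma seq_least (s : seq G) : s != [::] ->
  exists2 m, m \in s & forall g, g \in s -> g != m -> lt m g.
Proof.
have [irr tr add tot] := ltP.
elim: s => // a s IH _; have [->|/IH [m ms mP]] := eqVneq s [::].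
  by exists a; rewrite ?mem_head // => g; rewrite inE => ->.
have [am|nam] := eqVneq a m.
  by exists m; rewrite ?inE ?ms ?orbT // => g /orP[/eqP ->|/mP //]; rewrite am eqxx.
case: (tot _ _ nam) => [am|ma]; last first.
  by exists m; rewrite ?inE ?ms ?orbT // => g /orP[/eqP ->|/mP //].
exists a; rewrite ?mem_head // => g; rewrite inE => /orP[-> //|gs] _.
by have [->//|/(mP _ gs)] := eqVneq g m; apply: tr.
Qed.

(** Degree [m + m'] is reached in the expanded product only by the pair of least degrees. As the
    product is also homogeneous of degree [d], directness of the sum compares the two
    descriptions. *)
Lemma least_mul s s' (u u' : G -> T) m m' d :
  uniq s -> uniq s' -> (forall g, C g (u g)) -> (forall g, C g (u' g)) ->
  m \in s -> (forall g, g \in s -> g != m -> lt m g) ->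
  m' \in s' -> (forall g, g \in s' -> g != m' -> lt m' g) ->
  let t := (\sum_(g <- s) u g) * (\sum_(g <- s') u' g) in
  C d t -> u m * u' m' = if m + m' == d then t else 0.
Proof.
have [irr tr add tot] := ltP.
move=> us us' uC uC' ms mP ms' mP' t td.
pose L := [seq (g, g') | g <- s, g' <- s'].
pose S := undup (d :: m + m' :: [seq p.1 + p.2 | p <- L]).
(* The degree [g] part of the expanded product minus that of [t]; these differences add up to 0, so
   each one vanishes. *)
pose w g := \sum_(p <- L | p.1 + p.2 == g) (u p.1 * u' p.2) - (if g == d then t else 0).
have tE : t = \sum_(p <- L) u p.1 * u' p.2.
  by rewrite /L big_allpairs /t big_distrl /=; apply: eq_bigr => g _; rewrite big_distrr.
have uniqS : uniq S by exact: undup_uniq.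
have dS : d \in S by rewrite mem_undup mem_head.
have wC g : C g (w g).
  apply: CD; first by apply: C_sum => p /eqP <-; apply: CM.
  by apply: CN; case: eqP => [->|].
have sum0 : \sum_(g <- S) w g = 0.
  rewrite sumrB -(@sum_by_degree _ L (fun p => p.1 + p.2)) //; last first.
    by apply/allP => p pL; rewrite mem_undup !inE (map_f (fun p => p.1 + p.2) pL) !orbT.
  rewrite -tE -big_mkcond /= (big_rem d) //= eqxx big1_seq ?addr0 ?subrr // => g.
  by rewrite (rem_filter _ uniqS) mem_filter => /andP[/eqP -> /=]; rewrite eqxx.
have := direct uniqS wC sum0 (g := m + m').
rewrite mem_undup !inE eqxx orbT => /(_ isT) /eqP; rewrite subr_eq0 => /eqP <-.
rewrite big_mkcond (bigD1_seq (m, m')) /= ?allpairs_uniq ?eqxx //; first last.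
- by move=> [a b] [a' b'] _ _ [-> ->].
- exact: allpairs_f.
rewrite big1_seq ?addr0 // => -[a b] /= /andP[ne /allpairsP [[a' b'] /= [as_ bs]]].
case=> Ea Eb; subst a' b'; case: eqP => // E.
have le (x y z : G) : lt x y -> lt (z + x) (z + y) by rewrite ![z + _]addrC; exact: add.
have [am|nam] := eqVneq a m.
  have [bm|nbm] := eqVneq b m'; first by rewrite am bm eqxx in ne.
  by case: (irr (m + m')); rewrite -{2}E am; apply/le/mP'.
have H := add _ _ m' (mP a as_ nam).
have [bm|nbm] := eqVneq b m'; first by case: (irr (m + m')); rewrite -{2}E bm.
by case: (irr (m + m')); rewrite -{2}E; apply: tr H _; apply/le/mP'.
Qed.

End Extremal.

Variable lt : G -> G -> Prop.
Hypothesis ltP : ordered_group lt.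

(** A vanishing product is homogeneous of degree [m + m'] too, so [least_mul] would make the product
    of the least components 0. *)
Lemma graded_domain t t' : hsum t -> hsum t' -> t != 0 -> t' != 0 -> t * t' != 0.
Proof.
move=> /hsum_normal [s [u [us uC unz ->]]] /hsum_normal [s' [u' [us' uC' unz' ->]]] nz nz'.
have [m ms mP] : exists2 m, m \in s & forall g, g \in s -> g != m -> lt m g.
  by apply: seq_least => //; apply: contraNneq nz => ->; rewrite big_nil.
have [m' ms' mP'] : exists2 m, m \in s' & forall g, g \in s' -> g != m -> lt m g.
  by apply: seq_least => //; apply: contraNneq nz' => ->; rewrite big_nil.
apply/negP => /eqP t0.
have := least_mul ltP us us' uC uC' ms mP ms' mP' (d := m + m').
by rewrite t0 eqxx => /(_ (C0 _)) /eqP; apply/negP/(C_nz (g := m) (g' := m')); auto.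
Qed.

(** The products of the least and of the greatest components are nonzero, so both lie in degree 0: m
    + m' = 0 = M + M'. By monotonicity m = M and m' = M', and only one degree occurs in each
    factor. *)
Lemma graded_unit t t' : hsum t -> hsum t' -> t * t' != 0 -> C 0 (t * t') ->
  exists2 g, C g t & C (- g) t'.
Proof.
move=> /hsum_normal [s [u [us uC unz tE]]] /hsum_normal [s' [u' [us' uC' unz' tE']]] nz tC.
have s0 : s != [::] by apply: contraNneq nz => sE; rewrite tE sE big_nil mul0r.
have s0' : s' != [::] by apply: contraNneq nz => sE; rewrite tE' sE big_nil mulr0.
have ltP' := ordered_group_flip ltP.
have [m ms mP] := seq_least ltP s0; have [m' ms' mP'] := seq_least ltP s0'.
have [M Ms MP] := seq_least ltP' s0; have [M' Ms' MP'] := seq_least ltP' s0'.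
rewrite tE tE' in tC.
have sum0 : m + m' = 0.
  apply/eqP; have := least_mul ltP us us' uC uC' ms mP ms' mP' tC.
  by case: eqP => // _ /eqP; apply/contraTT => _; apply/(C_nz (g := m) (g' := m')); auto.
have Sum0 : M + M' = 0.
  apply/eqP; have := least_mul ltP' us us' uC uC' Ms MP Ms' MP' tC.
  by case: eqP => // _ /eqP; apply/contraTT => _; apply/(C_nz (g := M) (g' := M')); auto.
have [irr tr add tot] := ltP.
have mM : m = M.
  apply/eqP/negPn/negP => nmM; apply: (irr 0).
  have H : lt m M by apply: mP; rewrite 1?eq_sym.
  have := add _ _ m' H; rewrite sum0 => H1.
  have [mM'|nmM'] := eqVneq m' M'; first by rewrite mM' Sum0 in H1.
  have H2 : lt m' M' by apply: mP'; rewrite 1?eq_sym.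
  by have := add _ _ M H2; rewrite [m' + M]addrC [M' + M]addrC Sum0; apply: tr.
have mM' : m' = M' by apply: (addrI m); rewrite sum0 mM Sum0.
have single (r : seq G) k : uniq r -> k \in r ->
    (forall g, g \in r -> g != k -> lt k g) -> (forall g, g \in r -> g != k -> lt g k) ->
    forall v : G -> T, \sum_(g <- r) v g = v k.
  move=> ur kr k1 k2 v; rewrite (bigD1_seq k) //= big1_seq ?addr0 // => g /andP[gk gr].
  by case: (irr k); apply: tr (k2 g gr gk); apply: k1.
exists m.
  by rewrite tE (single s m us ms mP) // => g gs; rewrite mM; apply: MP.
have -> : - m = m' by apply/eqP; rewrite eq_sym -addr_eq0 addrC sum0.
by rewrite tE' (single s' m' us' ms' mP') // => g gs; rewrite mM'; apply: MP'.
Qed.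

End Graded.

(** * Monomials in quantum Weyl algebras *)

Section Zpow.
Variables (K : fieldType) (B : algType K).
Implicit Types (u v : B) (k : int).

(** [v] need not be inverse to [u]. For [h], [hi] this is a genuine integer power; for [x], [y]
    negative exponents stand for powers of [y], and only steps away from 0 multiply without
    correction. *)
Definition zpow u v k : B := match k with Posz m => u ^+ m | Negz m => v ^+ m.+1 end.

Lemma zpow0 u v : zpow u v 0 = 1. Proof. exact: expr0. Qed.

Lemma zpow1 u v : zpow u v 1 = u. Proof. exact: expr1. Qed.

Lemma zpowN1 u v : zpow u v (-1) = v. Proof. exact: expr1. Qed.

Lemma zpow_succ u v k : 0 <= k -> zpow u v (k + 1) = zpow u v k * u.
Proof. by case: k => // m _; rewrite -PoszD addn1 /= exprSr. Qed.

Lemma zpow_pred u v k : k <= 0 -> zpow u v (k - 1) = zpow u v k * v.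
Proof.
case: k => [[|m]|m] // _; first by rewrite sub0r zpowN1 zpow0 mul1r.
by rewrite NegzE -opprD -PoszD addn1 -NegzE /= -exprSr.
Qed.

Lemma zpowS u v k : v * u = 1 -> zpow u v (k + 1) = zpow u v k * u.
Proof.
move=> vu; have [/zpow_succ -> //|k0] := leP 0 k.
rewrite -[in RHS](addrK 1 k) zpow_pred -?mulrA ?vu ?mulr1 //.
by rewrite -ltzD1 ltrD2r.
Qed.

Lemma zpowP u v k : u * v = 1 -> zpow u v (k - 1) = zpow u v k * v.
Proof.
move=> uv; have [/zpow_pred -> //|k0] := leP k 0.
by rewrite -[in RHS](subrK 1 k) zpow_succ -?mulrA ?uv ?mulr1 // subr_ge0.
Qed.

Lemma zpowD u v k l : u * v = 1 -> v * u = 1 -> zpow u v (k + l) = zpow u v k * zpow u v l.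
Proof.
move=> uv vu; elim: l => [|l IH|l IH]; first by rewrite addr0 zpow0 mulr1.
- by rewrite -addn1 PoszD addrA !(zpowS _ vu) IH mulrA.
- by rewrite -addn1 PoszD opprD addrA !(zpowP _ uv) IH mulrA.
Qed.

Lemma comm_zpow w u v k : GRing.comm w u -> GRing.comm w v -> GRing.comm w (zpow u v k).
Proof. by move=> wu wv; case: k => m; apply: commrX. Qed.

Definition qcomm (c : K) u v := u * v = c *: (v * u).

Lemma qcomm1 u v : qcomm 1 u v <-> GRing.comm u v.
Proof. by rewrite /qcomm scale1r. Qed.

Lemma qcomm1l u : qcomm 1 1 u.
Proof. by apply/qcomm1/commr_sym/commr1. Qed.

Lemma qcomm1r u : qcomm 1 u 1.
Proof. by apply/qcomm1/commr1. Qed.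

Lemma qcommMl c c' u u' v : qcomm c u v -> qcomm c' u' v -> qcomm (c * c') (u * u') v.
Proof.
move=> uv uv'; rewrite /qcomm -mulrA uv' -scalerAr [u * (v * u')]mulrA uv -scalerAl.
by rewrite scalerA mulrA mulrC.
Qed.

Lemma qcommMr c c' u v v' : qcomm c u v -> qcomm c' u v' -> qcomm (c * c') u (v * v').
Proof.
move=> uv uv'; rewrite /qcomm mulrA uv -scalerAl -[v * u * v']mulrA uv' -scalerAr scalerA mulrA.
by [].
Qed.

Lemma qcomm_sym c u v : c != 0 -> qcomm c u v -> qcomm c^-1 v u.
Proof. by move=> c0; rewrite /qcomm => ->; rewrite scalerA mulVf // scale1r. Qed.

Lemma qcomm_zpowr c w u v k : c != 0 -> qcomm c w u -> qcomm c^-1 w v ->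
  qcomm (c ^ k) w (zpow u v k).
Proof.
move=> c0 wu wv; case: k => m /=; last rewrite NegzE -exprnN -exprVn.
  by elim: m => [|m IH]; [exact: qcomm1r | rewrite exprS exprSz; apply: qcommMr].
by elim: m => [|m IH]; [rewrite !expr1 | rewrite exprS [v ^+ _]exprS; apply: qcommMr].
Qed.

Lemma qcomm_zpowl c u v w k : c != 0 -> qcomm c u w -> qcomm c^-1 v w ->
  qcomm (c ^ k) (zpow u v k) w.
Proof.
move=> c0 uw vw; case: k => m /=; last rewrite NegzE -exprnN -exprVn.
  by elim: m => [|m IH]; [exact: qcomm1l | rewrite exprS exprSz; apply: qcommMl].
by elim: m => [|m IH]; [rewrite !expr1 | rewrite exprS [v ^+ _]exprS; apply: qcommMl].
Qed.

Lemma qcomm_prodl n (c : 'I_n -> K) (F : 'I_n -> B) w :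
  (forall i, qcomm (c i) (F i) w) -> qcomm (\prod_i c i) (\prod_i F i) w.
Proof.
move=> H; apply: (big_ind2 (fun c u => qcomm c u w)) => //; first exact: qcomm1l.
by move=> *; apply: qcommMl.
Qed.

Lemma qcomm_prodr n (c : 'I_n -> K) (F : 'I_n -> B) w :
  (forall i, qcomm (c i) w (F i)) -> qcomm (\prod_i c i) w (\prod_i F i).
Proof.
move=> H; apply: (big_ind2 (fun c u => qcomm c w u)) => //; first exact: qcomm1r.
by move=> *; apply: qcommMr.
Qed.

End Zpow.

Lemma prod_delta (R : pzSemiRingType) n (j : 'I_n) (c : R) :
  \prod_i (if i == j then c else 1) = c.
Proof. by rewrite -big_mkcond big_pred1_eq. Qed.

Definition unitv n (j : 'I_n) : 'rV[int]_n := delta_mx 0 j.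

Lemma unitvE n (j i : 'I_n) : unitv j 0 i = (i == j)%:Z.
Proof. by rewrite mxE eqxx /= natz. Qed.

Lemma addvE n (a : 'rV[int]_n) j i : (a + unitv j) 0 i = a 0 i + (i == j)%:Z.
Proof. by rewrite mxE unitvE. Qed.

Lemma subvE n (a : 'rV[int]_n) j i : (a - unitv j) 0 i = a 0 i - (i == j)%:Z.
Proof. by rewrite !mxE eqxx /= natz. Qed.

Definition dot n (m a : 'rV[int]_n) : int := \sum_j m 0 j * a 0 j.

Lemma dot_unitvl n (j : 'I_n) a : dot (unitv j) a = a 0 j.
Proof.
rewrite /dot (bigD1 j) //= unitvE eqxx mul1r big1 ?addr0 // => i /negPf ij.
by rewrite unitvE ij mul0r.
Qed.

Lemma dotNr n (m a : 'rV[int]_n) : dot m (- a) = - dot m a.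
Proof. by rewrite /dot -sumrN; apply: eq_bigr => i _; rewrite mxE mulrN. Qed.

(* Both steps move away from 0 in the j-th coordinate: in that direction multiplying a
   monomial by x j or y j gives a monomial again, without a factor in h j. *)
Lemma rV_int_ind n (P : 'rV[int]_n -> Prop) : P 0 ->
  (forall (a : 'rV[int]_n) j, 0 <= a 0 j -> P a -> P (a + unitv j)) ->
  (forall (a : 'rV[int]_n) j, a 0 j <= 0 -> P a -> P (a - unitv j)) -> forall a, P a.
Proof.
(* Induction on the sum of the absolute values of the coordinates, which a step towards 0 in a
   nonzero coordinate lowers. *)
move=> P0 PS PN a; move: {2}(\sum_j absz (a 0%R j))%N (leqnn (\sum_j absz (a 0%R j))%N) => N.
have dec (b : 'rV[int]_n) (j : 'I_n) (c : 'rV[int]_n) :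
    (forall i, i != j -> c 0 i = b 0 i) -> (absz (c 0%R j) < absz (b 0%R j))%N ->
    (\sum_i absz (c 0%R i) < \sum_i absz (b 0%R i))%N.
  move=> H1 H2; rewrite (bigD1 j) //= [X in (_ < X)%N](bigD1 j) //=.
  rewrite -addSn leq_add //; apply: leq_sum => i ij; by rewrite H1.
elim: N a => [|N IH] a aN.
  suff -> : a = 0 by [].
  apply/rowP => j; rewrite mxE; apply/eqP; rewrite -absz_eq0 -leqn0.
  by apply: leq_trans aN; rewrite (bigD1 j) //= leq_addr.
have [->//|] := eqVneq a 0.
case/rV0Pn => j; case: (ltrgtP (a 0 j) 0) => // aj _.
- rewrite -[a](addrK (unitv j)); apply: PN.
    by rewrite addvE eqxx -ltzD1 ltrD2r.
  apply/IH; rewrite -ltnS; apply: leq_trans aN; apply: (dec _ j) => [i /negPf ij|].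
    by rewrite addvE ij addr0.
  rewrite addvE eqxx; move: aj; case: (a 0 j) => // m _.
  by rewrite NegzE -[m.+1]addn1 PoszD opprD subrK -opprD !abszN /= addn1.
- rewrite -[a](subrK (unitv j)); apply: PS.
    by rewrite subvE eqxx subr_ge0.
  apply/IH; rewrite -ltnS; apply: leq_trans aN; apply: (dec _ j) => [i /negPf ij|].
    by rewrite subvE ij subr0.
  rewrite subvE eqxx; move: aj; case: (a 0 j) => // [[|m]] // _.
  by rewrite -[m.+1]addn1 PoszD addrK -PoszD /= addn1.
Qed.

Section Monom.
Variables (K : fieldType) (B : algType K) (n : nat).
Implicit Types u v : 'I_n -> B.

Definition monom u v (a : 'rV[int]_n) : B := \prod_j zpow (u j) (v j) (a 0 j).

Lemma monom0 u v : monom u v 0 = 1.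
Proof. by rewrite /monom big1 // => j _; rewrite mxE zpow0. Qed.

Lemma monom_unitv u v j : monom u v (unitv j) = u j.
Proof.
rewrite /monom -[RHS](prod_delta j); apply: eq_bigr => i _.
by rewrite unitvE; case: eqP => [->|_]; [exact: zpow1 | exact: zpow0].
Qed.

Lemma monom_unitvN u v j : monom u v (- unitv j) = v j.
Proof.
rewrite /monom -[RHS](prod_delta j); apply: eq_bigr => i _.
by rewrite -[- _]add0r subvE mxE add0r; case: eqP => [->|_]; [exact: zpowN1 | exact: zpow0].
Qed.

End Monom.

(** * Commutation rules and linear independence of the monomials *)

Section QweylTheory.
Variables (K : fieldType) (q : K).
Hypothesis q0 : q != 0.
Hypothesis q_nroot : forall m : nat, (0 < m)%N -> q ^+ m != 1.

Lemma exprz_inj_q (k l : int) : q ^ k = q ^ l -> k = l.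
Proof.
move=> kl; apply/eqP; rewrite -subr_eq0.
have : q ^ (k - l) = 1 by rewrite expfzDr // kl -expfzDr // subrr.
case: (k - l) => [[|m]|m] // H.
- by case/eqP: (q_nroot (ltn0Sn m)); exact: H.
- by case/eqP: (q_nroot (ltn0Sn m)); apply: invr_inj; rewrite invr1; exact: H.
Qed.

Variables (B : algType K) (n : nat) (h hi x y : 'I_n -> B).
Hypothesis Q : qweyl q h hi x y.

Local Notation hm := (monom h hi).
Local Notation va := (monom x y).

Lemma comm_hiV (u : B) i : GRing.comm u (h i) -> GRing.comm u (hi i).
Proof.
move=> uh; rewrite /GRing.comm -[u in LHS]mul1r -(qw_Vh Q i) -(mulrA (hi i)) -uh.
by rewrite -!mulrA (qw_hV Q) mulr1.
Qed.

Lemma hh_comm i j : GRing.comm (h i) (h j).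
Proof. by have [->|/(qw_hh Q)] := eqVneq i j. Qed.

Lemma hhi_comm i j : GRing.comm (h i) (hi j).
Proof. exact/comm_hiV/hh_comm. Qed.

Lemma hihi_comm i j : GRing.comm (hi i) (hi j).
Proof. by apply: comm_hiV; apply/commr_sym/comm_hiV/hh_comm. Qed.

Lemma zpow_h_comm i j k l : GRing.comm (zpow (h i) (hi i) k) (zpow (h j) (hi j) l).
Proof.
apply: comm_zpow; apply/commr_sym/comm_zpow.
- exact: hh_comm.
- exact: hhi_comm.
- exact/commr_sym/hhi_comm.
- exact: hihi_comm.
Qed.

Lemma hmD m m' : hm (m + m') = hm m * hm m'.
Proof.
rewrite /monom -prodrM_comm => [|i j _ _]; last exact: zpow_h_comm.
by apply: eq_bigr => j _; rewrite mxE zpowD ?(qw_hV Q) ?(qw_Vh Q).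
Qed.

Lemma hmNK m : hm m * hm (- m) = 1. Proof. by rewrite -hmD subrr monom0. Qed.

Lemma hmKN m : hm (- m) * hm m = 1. Proof. by rewrite -hmD addNr monom0. Qed.

Lemma hm_comm m m' : GRing.comm (hm m) (hm m').
Proof. by rewrite /GRing.comm -!hmD addrC. Qed.

Lemma hm_x (m : 'rV[int]_n) j : qcomm (q ^ (m 0 j)) (hm m) (x j).
Proof.
rewrite -(prod_delta j (q ^ (m 0 j))); apply: qcomm_prodl => i.
case: eqP => [->|/eqP ij].
- have hx : qcomm q (h j) (x j) by exact: qw_hx Q j.
  apply: qcomm_zpowl => //; rewrite /qcomm -[LHS]mulr1 -(qw_hV Q j).
  rewrite -mulrA [x j * (_ * _)]mulrA.
  have -> : x j * h j = q^-1 *: (h j * x j) by rewrite hx scalerA mulVf ?scale1r.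
  by rewrite -!scalerAl -scalerAr !mulrA (qw_Vh Q) mul1r.
- apply/qcomm1/commr_sym/comm_zpow; [|apply/comm_hiV]; exact/commr_sym/(qw_hxC Q).
Qed.

Lemma hm_y (m : 'rV[int]_n) j : qcomm (q ^ (m 0 j))^-1 (hm m) (y j).
Proof.
rewrite -(prod_delta j (q ^ (m 0 j))^-1); apply: qcomm_prodl => i.
case: eqP => [->|/eqP ij].
- have yh : qcomm q (y j) (h j) by exact: qw_yh Q j.
  rewrite invr_expz -exprz_inv; apply: qcomm_zpowl; rewrite ?invr_eq0 ?invrK //.
    exact: qcomm_sym.
  rewrite /qcomm -[LHS]mulr1 -(qw_hV Q j) -mulrA [y j * (_ * _)]mulrA yh.
  by rewrite -!scalerAl -scalerAr !mulrA (qw_Vh Q) mul1r.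
- apply/qcomm1/commr_sym/comm_zpow; [|apply/comm_hiV]; exact/commr_sym/(qw_hyC Q).
Qed.

Lemma hm_va m a : qcomm (q ^ (dot m a)) (hm m) (va a).
Proof.
have -> : q ^ (dot m a) = \prod_j (q ^ (m 0 j)) ^ (a 0 j).
  rewrite /dot (big_morph (exprz q) (id1 := 1) (op1 := *%R)) //; last first.
    by move=> k l; rewrite expfzDr.
  by apply: eq_bigr => j _; rewrite exprzAC -exprz_exp // exprzAC.
apply: qcomm_prodr => j; apply: qcomm_zpowr; rewrite ?expfz_neq0 //.
- exact: hm_x.
- exact: hm_y.
Qed.

Lemma va_x_succ (a : 'rV[int]_n) j : 0 <= a 0 j -> GRing.comm (x j) (va a) /\ va (a + unitv j) = va a * x j.
Proof.
move=> aj; have cx i : GRing.comm (x j) (zpow (x i) (y i) (a 0 i)).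
  have [->|ij] := eqVneq i j; first by case: (a 0 j) aj => // m _; exact/commrX.
  by apply: comm_zpow; [apply: (qw_xxC Q) | apply: (qw_xyC Q)]; rewrite eq_sym.
split; first by apply: commr_prod.
rewrite -[x j in RHS](prod_delta j) /monom -prodrM_comm => [|i k _ _].
  apply: eq_bigr => i _; rewrite addvE; case: eqP => [->|_]; last by rewrite addr0 mulr1.
  exact: zpow_succ.
by case: eqP => _; [apply/commr_sym | exact: commr1].
Qed.

Lemma va_y_pred (a : 'rV[int]_n) j : a 0 j <= 0 -> GRing.comm (y j) (va a) /\ va (a - unitv j) = va a * y j.
Proof.
move=> aj; have cy i : GRing.comm (y j) (zpow (x i) (y i) (a 0 i)).
  have [->|ij] := eqVneq i j.
    by case: (a 0 j) aj => [[|m]|m] // _; [exact: commr1 | exact/commrX].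
  by apply: comm_zpow; [apply/commr_sym/(qw_xyC Q) | apply: (qw_yyC Q); rewrite eq_sym].
split; first by apply: commr_prod.
rewrite -[y j in RHS](prod_delta j) /monom -prodrM_comm => [|i k _ _].
  apply: eq_bigr => i _; rewrite subvE; case: eqP => [->|_]; last by rewrite subr0 mulr1.
  exact: zpow_pred.
by case: eqP => _; [apply/commr_sym | exact: commr1].
Qed.

Lemma va_h (a : 'rV[int]_n) j : va a * h j = q ^ (- a 0 j) *: (h j * va a).
Proof.
have := hm_va (unitv j) a; rewrite dot_unitvl monom_unitv => ->.
by rewrite scalerA -expfzDr // addNr expr0z scale1r.
Qed.

Lemma h_mul_eq0 j u : h j * u = 0 -> u = 0.
Proof. by move=> H; rewrite -[u]mul1r -(qw_Vh Q j) -mulrA H mulr0. Qed.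

(** If va a x_j = 0 with a_j >= 0, multiplying by y_j on either side kills va a by q h_j - 1 from
    the left and by h_j - 1 from the right. Moving h_j across va a then forces q = q^(-a_j), which
    is impossible. The step with y_j is symmetric. *)
Lemma va_neq0 a : va a != 0.
Proof.
elim/rV_int_ind: a => [|a j aj vnz|a j aj vnz]; first by rewrite monom0 oner_neq0.
- have [cx E] := va_x_succ aj; apply: contraNneq vnz; rewrite E => H.
  have H1 : (q *: h j - 1) * va a = 0 by rewrite -(qw_yx Q) -mulrA cx H mulr0.
  have H2 : va a * (h j - 1) = 0 by rewrite -(qw_xy Q) mulrA H mul0r.
  move: H1 H2; rewrite mulrBl mulrBr mul1r mulr1 va_h -scalerAl => /subr0_eq H1 /subr0_eq H2.
  have : (q - q ^ (- a 0 j)) *: (h j * va a) = 0 by rewrite scalerBl H1 H2 subrr.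
  rewrite scalerAr => /h_mul_eq0 /eqP; rewrite scaler_eq0 subr_eq0 => /orP[/eqP|//].
  rewrite -{1}[q]expr1z => /exprz_inj_q E1.
  by move: aj; rewrite -oppr_le0 -E1.
- have [cy E] := va_y_pred aj; apply: contraNneq vnz; rewrite E => H.
  have H1 : (h j - 1) * va a = 0 by rewrite -(qw_xy Q) -mulrA cy H mulr0.
  have H2 : va a * (q *: h j - 1) = 0 by rewrite -(qw_yx Q) mulrA H mul0r.
  move: H1 H2; rewrite mulrBl mulrBr mul1r mulr1 -scalerAr va_h scalerA => /subr0_eq H1 /subr0_eq H2.
  have : (q * q ^ (- a 0 j) - 1) *: (h j * va a) = 0 by rewrite scalerBl scale1r H2 H1 subrr.
  rewrite scalerAr => /h_mul_eq0 /eqP; rewrite scaler_eq0 subr_eq0 => /orP[/eqP|//].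
  rewrite -{1}[q]expr1z -expfzDr // -(expr0z q) => /exprz_inj_q /subr0_eq E1.
  by move: aj; rewrite -E1.
Qed.

(* Commuting with z = x j or z = y j, whichever commutes with va a, rescales the hm m by
   distinct powers of q: the combination z S - q^k S z has one term fewer than S. *)
Lemma hm_va_indep (s : seq 'rV[int]_n) a (c : 'rV[int]_n -> K) : uniq s ->
  \sum_(m <- s) c m *: (hm m * va a) = 0 -> forall m, m \in s -> c m = 0.
Proof.
elim: s a c => // m1 s IH a c /= /andP[m1s us] sum0.
have tl m : m \in s -> c m = 0.
  move=> ms; have nm : m != m1 by apply: contraNneq m1s => <-.
  have [j mj] : exists j, m 0 j != m1 0 j.
    apply/existsP; apply: contraR nm; rewrite negb_exists => /forallP H.
    by apply/eqP/rowP => i; apply/eqP/negPn/H.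
  have [z [a' [e [e_inj zva zhm]]]] : exists (z : B) (a' : 'rV[int]_n) (e : 'rV[int]_n -> K),
      [/\ forall m, e m = e m1 -> m 0 j = m1 0 j, z * va a = va a' /\ va a * z = va a'
        & forall m, z * hm m = e m *: (hm m * z)].
    case: (leP 0 (a 0 j)) => aj.
    - have [cx E] := va_x_succ aj; exists (x j), (a + unitv j), (fun m => q ^ (- m 0 j)).
      split=> [k /exprz_inj_q /oppr_inj //||k]; first by rewrite cx E.
      by rewrite (hm_x k j) scalerA -expfzDr // addNr expr0z scale1r.
    - have [cy E] := va_y_pred (ltW aj); exists (y j), (a - unitv j), (fun m => q ^ (m 0 j)).
      split=> [k /exprz_inj_q //||k]; first by rewrite cy E.
      by rewrite (hm_y k j) scalerA divff ?expfz_neq0 // scale1r.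
  have [zv vz] := zva.
  have E : \sum_(k <- s) (c k * (e k - e m1)) *: (hm k * va a') = 0.
    have : z * (\sum_(k <- m1 :: s) c k *: (hm k * va a))
        - e m1 *: ((\sum_(k <- m1 :: s) c k *: (hm k * va a)) * z) = 0.
      by rewrite sum0 mulr0 mul0r scaler0 subr0.
    rewrite big_distrl big_distrr scaler_sumr -sumrB /= big_cons => E0; rewrite -[RHS]E0 {E0}.
    have term k : z * (c k *: (hm k * va a)) - e m1 *: (c k *: (hm k * va a) * z)
        = (c k * (e k - e m1)) *: (hm k * va a').
      rewrite -scalerAr -scalerAl mulrA zhm -!scalerAl -!mulrA zv vz !scalerA -scalerBl.
      by congr (_ *: _); rewrite mulrBr [e m1 * _]mulrC.
    by rewrite term subrr mulr0 scale0r add0r; apply: eq_bigr => k _; rewrite term.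
  have /eqP := IH _ _ us E m ms; rewrite mulf_eq0 subr_eq0 => /orP[/eqP //|/eqP /e_inj H].
  by rewrite H eqxx in mj.
move=> m; rewrite inE => /orP[/eqP ->|/tl //].
move: sum0; rewrite big_cons big1_seq ?addr0 => [/eqP|k /andP[_ /tl ->]]; last exact: scale0r.
rewrite scaler_eq0 => /orP[/eqP //|/eqP H].
by have := va_neq0 a; rewrite -[va a]mul1r -(hmKN m1) -mulrA H mulr0 eqxx.
Qed.

End QweylTheory.

(** * The grading by weights *)

Section QweylGrading.
Variables (K : fieldType) (q : K).
Hypothesis q0 : q != 0.
Hypothesis q_nroot : forall m : nat, (0 < m)%N -> q ^+ m != 1.
Variables (B : algType K) (n : nat) (h hi x y : 'I_n -> B).
Hypothesis Q : qweyl q h hi x y.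
Local Notation hm := (monom h hi).
Local Notation va := (monom x y).
Implicit Types (m a b : 'rV[int]_n) (p r t : B).

(* Below, [inR] is the algebra of Laurent polynomials in the h j, and [vcomp a], which is
   [inR * va a], consists of vectors of weight a for conjugation by the h j. *)
Definition hcomp m t := exists c : K, t = c *: hm m.

Lemma hcomp_0 m : hcomp m 0.
Proof. by exists 0; rewrite scale0r. Qed.

Lemma hcompD m t t' : hcomp m t -> hcomp m t' -> hcomp m (t + t').
Proof. by move=> [c ->] [d ->]; exists (c + d); rewrite scalerDl. Qed.

Lemma hcompN m t : hcomp m t -> hcomp m (- t).
Proof. by move=> [c ->]; exists (- c); rewrite scaleNr. Qed.

Lemma hcompM m m' t t' : hcomp m t -> hcomp m' t' -> hcomp (m + m') (t * t').
Proof.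
move=> [c ->] [d ->]; exists (c * d).
by rewrite -scalerAl -scalerAr scalerA (hmD Q).
Qed.

Lemma hcomp_direct (s : seq 'rV[int]_n) (u : 'rV[int]_n -> B) : uniq s ->
  (forall m, hcomp m (u m)) -> \sum_(m <- s) u m = 0 -> forall m, m \in s -> u m = 0.
Proof.
move=> us /choice [c cE] sum0 m ms; rewrite cE (hm_va_indep q0 q_nroot Q (a := 0) us _ ms) ?scale0r //.
by rewrite -[RHS]sum0; apply: eq_bigr => k _; rewrite monom0 mulr1 cE.
Qed.

Lemma hm_neq0 m : hm m != 0.
Proof.
by apply/eqP => H; have := hmNK Q m; rewrite H mul0r => /esym/eqP; rewrite oner_eq0.
Qed.

Lemma hcomp_nz m m' t t' : hcomp m t -> hcomp m' t' -> t != 0 -> t' != 0 -> t * t' != 0.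
Proof.
move=> [c ->] [d ->]; rewrite !scaler_eq0 !negb_or => /andP[c0 _] /andP[d0 _].
by rewrite -scalerAl -scalerAr scalerA -(hmD Q) scaler_eq0 mulf_eq0 !negb_or c0 d0 hm_neq0.
Qed.

Definition inR := hsum hcomp.

Lemma inR_hm c m : inR (c *: hm m).
Proof. by apply: (hsum_homog (g := m)); exists c. Qed.

Lemma inR_scalar c : inR (c *: 1).
Proof. by rewrite -(monom0 h hi); exact: inR_hm. Qed.

Lemma inR1 : inR 1. Proof. by rewrite -[1]scale1r; exact: inR_scalar. Qed.

Lemma inR0 : inR 0. Proof. exact: hsum_homog (hcomp_0 0). Qed.

Lemma inRD p r : inR p -> inR r -> inR (p + r). Proof. exact: hsumD. Qed.

Lemma inRM p r : inR p -> inR r -> inR (p * r).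
Proof. exact: (hsumM hcomp_0 hcompM). Qed.

Lemma inRZ c p : inR p -> inR (c *: p).
Proof. by move=> Rp; rewrite -[p]mul1r scalerAl; apply: inRM => //; exact: inR_scalar. Qed.

Lemma inRN p : inR p -> inR (- p).
Proof. by rewrite -scaleN1r; exact: inRZ. Qed.

Lemma inR_h j : inR (h j).
Proof. by rewrite -[h j]scale1r -(monom_unitv h hi); exact: inR_hm. Qed.

Lemma inR_lin c j : inR (c *: h j - 1).
Proof. by apply: inRD; [apply/inRZ/inR_h | apply/inRN/inR1]. Qed.

Lemma inR_domain p r : inR p -> inR r -> p != 0 -> r != 0 -> p * r != 0.
Proof.
exact: (graded_domain hcomp_0 hcompD hcompN hcompM hcomp_direct hcomp_nz (@lex_ordered n)).
Qed.

(** In the grading by exponents every component is spanned by one monomial, and [graded_unit] makes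
    a unit homogeneous. *)
Lemma inR_unit p r : inR p -> inR r -> p * r = 1 ->
  exists c m, [/\ c != 0, p = c *: hm m & r = c^-1 *: hm (- m)].
Proof.
move=> Rp Rr pr.
have [||m [c cE] [d dE]] := graded_unit hcomp_0 hcompD hcompN hcompM hcomp_direct hcomp_nz
  (@lex_ordered n) Rp Rr; rewrite ?pr ?oner_neq0 //.
  by exists 1; rewrite monom0 scale1r.
have cd : c * d = 1.
  move: pr; rewrite cE dE -scalerAl -scalerAr scalerA (hmNK Q) -[RHS]scale1r => /eqP.
  by rewrite -subr_eq0 -scalerBl scaler_eq0 oner_eq0 orbF subr_eq0 => /eqP.
have c0 : c != 0 by apply/eqP => H; have := oner_neq0 K; rewrite -cd H mul0r eqxx.
by exists c, m; split=> //; rewrite dE -[c^-1]mulr1 -cd mulKf.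
Qed.

Lemma inR_ind (P : B -> Prop) : P 0 -> (forall p r, P p -> P r -> P (p + r)) ->
  (forall c m, P (c *: hm m)) -> forall p, inR p -> P p.
Proof.
move=> P0 PD Ph p [L LC ->]; rewrite big_seq; apply: (big_ind P) => // i /LC [c ->]; exact: Ph.
Qed.

Lemma inR_comm p r : inR p -> inR r -> GRing.comm p r.
Proof.
move=> Rp Rr; move: p Rp; apply: inR_ind => [|p1 p2 H1 H2|c m].
- exact/commr_sym/commr0.
- by apply/commr_sym/commrD; apply/commr_sym.
- apply/commr_sym/commr_scale/commr_sym; move: r Rr; apply: inR_ind => [|p1 p2|d m'].
  + exact: commr0.
  + exact: commrD.
  + exact/commr_scale/(hm_comm Q).
Qed.

Lemma inR_va_reg p a : inR p -> p * va a = 0 -> p = 0.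
Proof.
move=> Rp; have [s [u [us /choice [c cE] _ ->]]] := hsum_normal hcomp_0 hcompD Rp.
rewrite big_distrl /= => sum0; rewrite big1_seq // => m /andP[_ ms].
rewrite cE (hm_va_indep q0 q_nroot Q (a := a) us _ ms) ?scale0r //.
by rewrite -[RHS]sum0; apply: eq_bigr => k _; rewrite cE scalerAl.
Qed.

(** Passing [va a] across [hm m] only rescales it by a power of q. The new coefficients vanish
    exactly when the old ones do, which gives the last clause through independence. *)
Lemma va_inR p a : inR p -> exists r, [/\ inR r, va a * p = r * va a & p != 0 -> r != 0].
Proof.
move=> Rp.
have ex b p' : inR p' -> exists2 r, inR r & r * va b = va b * p'.
  move: p'; apply: inR_ind => [|p1 p2 [r1 R1 E1] [r2 R2 E2]|c m].
  - by exists 0; [exact: inR0 | rewrite mul0r mulr0].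
  - by exists (r1 + r2); [exact: inRD | rewrite mulrDl mulrDr E1 E2].
  - exists ((c / q ^ dot m b) *: hm m); first exact: inR_hm.
    rewrite -scalerAl (hm_va q0 Q m b) scalerA divfK ?expfz_neq0 //.
    by rewrite -scalerAr.
have [r Rr rE] := ex a p Rp; exists r; split=> //.
have [s [u [us /choice [c cE] unz pE]]] := hsum_normal hcomp_0 hcompD Rp.
apply: contraNneq => r0; move: rE; rewrite r0 mul0r {1}pE big_distrr /= => /esym sum0.
rewrite pE big1_seq // => m /andP[_ ms]; apply/eqP; rewrite cE scaler_eq0.
have := hm_va_indep q0 q_nroot Q (a := a) (c := fun m => c m / q ^ dot m a) us _ ms.
move=> H; apply/orP; left; have /eqP : c m / q ^ dot m a = 0.
  apply: H; rewrite -[RHS]sum0; apply: eq_bigr => k _.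
  by rewrite cE -scalerAr (hm_va q0 Q k a) scalerA divfK ?expfz_neq0.
by rewrite mulf_eq0 invr_eq0 expfz_eq0 (negPf q0) andbF orbF.
Qed.

(** Serves twice: with [e] zero to see that c h_j - 1 is nonzero, and in general to see that it is
    not a unit. *)
Lemma binomial_neq_monomial c d m m' b e : m != m' -> c != 0 -> d != 0 ->
  c *: hm m + d *: hm m' = e *: hm b -> False.
Proof.
move=> mm' c0 d0 E; pose s := undup [:: m; m'; b].
(* [b] may coincide with [m] or [m'], so the coefficients are collected as sums of indicators. *)
pose f k := (if k == m then c else 0) + (if k == m' then d else 0) - (if k == b then e else 0).
have pick k (v : K) : k \in s -> \sum_(i <- s) (if i == k then v else 0) *: hm i = v *: hm k.
  move=> ks; rewrite (big_rem k) //= eqxx big1_seq ?addr0 // => i.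
  rewrite (rem_filter _ (undup_uniq _)) mem_filter => /andP[_ /andP[/= /negPf -> _]].
  by rewrite scale0r.
have ins : [/\ m \in s, m' \in s & b \in s] by rewrite !mem_undup !inE !eqxx !orbT.
have [ms ms' bs] := ins.
have sum0 : \sum_(k <- s) f k *: (hm k * va 0) = 0.
  under eq_bigr do rewrite monom0 mulr1 /f scalerBl scalerDl.
  by rewrite sumrB big_split /= !pick // E subrr.
have H := hm_va_indep q0 q_nroot Q (undup_uniq _) sum0.
have [bm|nbm] := eqVneq b m.
  by have := H _ ms'; rewrite /f bm eqxx eq_sym (negPf mm') add0r subr0 => /eqP; apply/negP.
have := H _ ms; rewrite /f eqxx (negPf mm') eq_sym (negPf nbm) addr0 subr0 => /eqP.
by apply/negP.
Qed.

Lemma unitv_neq0 (j : 'I_n) : unitv j != 0.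
Proof. by apply/eqP => /rowP /(_ j); rewrite unitvE eqxx mxE. Qed.

Lemma lin_neq0 c j : c != 0 -> c *: h j - 1 != 0.
Proof.
move=> c0; apply/negP => /eqP H.
apply: (@binomial_neq_monomial c (-1) (unitv j) 0 0 0); rewrite ?unitv_neq0 ?oppr_eq0 ?oner_neq0 //.
by rewrite monom_unitv monom0 scale0r scaleN1r.
Qed.

Lemma lin_nunit r c j : c != 0 -> inR r -> r * (c *: h j - 1) <> 1.
Proof.
move=> c0 Rr H; have [d [m [_ _ E]]] := inR_unit Rr (inR_lin c j) H.
apply: (@binomial_neq_monomial c (-1) (unitv j) 0 (- m) d^-1); rewrite ?unitv_neq0 ?oppr_eq0 ?oner_neq0 //.
by rewrite monom_unitv monom0 scaleN1r.
Qed.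

Lemma va_lin a c j : va a * (c *: h j - 1) = ((c * q ^ (- a 0 j)) *: h j - 1) * va a.
Proof. by rewrite mulrBr mulrBl mulr1 mul1r -scalerAr -scalerAl (va_h q0 Q) scalerA. Qed.

(** For a_j < 0 a factor y_j can be split off at the right of [va a]; it meets x_j, and y_j x_j = q
    h_j - 1 moved to the left is [w]. Otherwise [w] is 1. *)
Lemma va_x a j : exists w, [/\ inR w, w != 0 & va a * x j = w * va (a + unitv j)].
Proof.
case: (leP 0 (a 0 j)) => aj.
  have [_ E] := va_x_succ Q aj; exists 1.
  by rewrite mul1r E; split=> //; [exact: inR1 | exact: oner_neq0].
have aj' : (a + unitv j) 0 j <= 0 by rewrite addvE eqxx -ltzD1 ltrD2r.
have [_ E] := va_y_pred Q aj'; rewrite addrK in E.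
exists ((q * q ^ (- (a + unitv j) 0 j)) *: h j - 1).
rewrite {1}E -mulrA (qw_yx Q) va_lin; split; [exact: inR_lin | | by []].
by apply: lin_neq0; rewrite mulf_neq0 ?expfz_neq0.
Qed.

Lemma va_y a j : exists w, [/\ inR w, w != 0 & va a * y j = w * va (a - unitv j)].
Proof.
case: (leP (a 0 j) 0) => aj.
  have [_ E] := va_y_pred Q aj; exists 1.
  by rewrite mul1r E; split=> //; [exact: inR1 | exact: oner_neq0].
have aj' : 0 <= (a - unitv j) 0 j by rewrite subvE eqxx subr_ge0.
have [_ E] := va_x_succ Q aj'; rewrite subrK in E.
exists ((1 * q ^ (- (a - unitv j) 0 j)) *: h j - 1).
have := va_lin (a - unitv j) 1 j; rewrite scale1r => vl.
rewrite {1}E -mulrA (qw_xy Q) vl; split; [exact: inR_lin | | by []].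
by apply: lin_neq0; rewrite mul1r expfz_neq0.
Qed.

Lemma va_mul a b : exists w, [/\ inR w, w != 0 & va a * va b = w * va (a + b)].
Proof.
elim/rV_int_ind: b => [|b j bj [w [Rw w0 wE]]|b j bj [w [Rw w0 wE]]].
- by exists 1; rewrite mul1r monom0 mulr1 addr0; split=> //; [exact: inR1 | exact: oner_neq0].
- have [_ ->] := va_x_succ Q bj; have [w' [Rw' w0' wE']] := va_x (a + b) j.
  by exists (w * w'); rewrite mulrA wE -[LHS]mulrA wE' mulrA addrA; split; [exact: inRM | exact: inR_domain |].
- have [_ ->] := va_y_pred Q bj; have [w' [Rw' w0' wE']] := va_y (a + b) j.
  by exists (w * w'); rewrite mulrA wE -[LHS]mulrA wE' mulrA addrA; split; [exact: inRM | exact: inR_domain |].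
Qed.

Definition vcomp a t := exists2 p, inR p & t = p * va a.

Lemma vcomp_0 a : vcomp a 0.
Proof. by exists 0; rewrite ?mul0r //; exact: inR0. Qed.

Lemma vcompD a t t' : vcomp a t -> vcomp a t' -> vcomp a (t + t').
Proof. by move=> [p Rp ->] [r Rr ->]; exists (p + r); rewrite ?mulrDl //; exact: inRD. Qed.

Lemma vcompN a t : vcomp a t -> vcomp a (- t).
Proof. by move=> [p Rp ->]; exists (- p); rewrite ?mulNr //; exact: inRN. Qed.

(** [va a] is pushed past [r] and merged with [va b]; the factors picked up on the way are nonzero
    elements of the domain [inR]. *)
Lemma vcompM_nz a b t t' : vcomp a t -> vcomp b t' ->
  vcomp (a + b) (t * t') /\ (t != 0 -> t' != 0 -> t * t' != 0).
Proof.
move=> [p Rp ->] [r Rr ->]; have [r' [Rr' E r0]] := va_inR a Rr.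
have [w [Rw w0 wE]] := va_mul a b.
have -> : p * va a * (r * va b) = p * r' * w * va (a + b).
  by rewrite -!mulrA [va a * (r * _)]mulrA E -wE !mulrA.
split=> [|p0 rv0]; first by exists (p * r' * w) => //; do !apply: inRM.
have nz : p * r' * w != 0.
  apply: inR_domain => //; first exact: inRM.
  apply: inR_domain => //; first by apply: contraNneq p0 => ->; rewrite mul0r.
  by apply: r0; apply: contraNneq rv0 => ->; rewrite mul0r.
by apply: contraNneq nz => /inR_va_reg -> //; do !apply: inRM.
Qed.

Lemma vcompM a b t t' : vcomp a t -> vcomp b t' -> vcomp (a + b) (t * t').
Proof. by move=> Ct Ct'; have [] := vcompM_nz Ct Ct'. Qed.

Lemma vcomp_nz a b t t' : vcomp a t -> vcomp b t' -> t != 0 -> t' != 0 -> t * t' != 0.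
Proof. by move=> Ct Ct'; have [] := vcompM_nz Ct Ct'. Qed.

Lemma vcomp_weight0 t : inR t <-> vcomp 0 t.
Proof. by split=> [Rt|[p Rp ->]]; [exists t; rewrite ?monom0 ?mulr1 | rewrite monom0 mulr1]. Qed.

Lemma vcomp_hm a t m : vcomp a t -> qcomm (q ^ dot m a) (hm m) t.
Proof.
move=> [p Rp ->]; rewrite -[q ^ _]mul1r; apply: qcommMr; last exact: hm_va.
by apply/qcomm1/inR_comm => //; rewrite -[hm m]scale1r; exact: inR_hm.
Qed.

(** Eigenvectors with distinct joint eigenvalues are independent: h_j S - q^(a1_j) S h_j loses the
    [a1] term of the sum S, while a term whose weight differs at j is only multiplied by a nonzero
    scalar and the unit h_j. *)
Lemma eigen_direct (s : seq 'rV[int]_n) (u : 'rV[int]_n -> B) : uniq s ->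
  (forall a j, qcomm (q ^ (a 0 j)) (h j) (u a)) -> \sum_(a <- s) u a = 0 ->
  forall a, a \in s -> u a = 0.
Proof.
elim: s u => // a1 s IH u /= /andP[a1s us] uE sum0.
have tl a : a \in s -> u a = 0.
  move=> as_; have na : a != a1 by apply: contraNneq a1s => <-.
  have [j aj] : exists j, a 0 j != a1 0 j.
    apply/existsP; apply: contraR na; rewrite negb_exists => /forallP H.
    by apply/eqP/rowP => i; apply/eqP/negPn/H.
  pose u' b := (q ^ (b 0 j) - q ^ (a1 0 j)) *: (u b * h j).
  have E : \sum_(b <- s) u' b = 0.
    have : h j * (\sum_(b <- a1 :: s) u b) - q ^ (a1 0 j) *: ((\sum_(b <- a1 :: s) u b) * h j) = 0.
      by rewrite sum0 mulr0 mul0r scaler0 subr0.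
    rewrite big_distrl big_distrr scaler_sumr -sumrB /= big_cons => E0; rewrite -[RHS]E0 {E0}.
    have term b : h j * u b - q ^ (a1 0 j) *: (u b * h j) = u' b.
      by rewrite (uE b j) -scalerBl.
    have u10 : u' a1 = 0 by rewrite /u' subrr scale0r.
    by rewrite term u10 add0r; apply: eq_bigr => b _; rewrite term.
  have uE' b i : qcomm (q ^ (b 0 i)) (h i) (u' b).
    have hjh : qcomm 1 (h i) (h j) by apply/qcomm1/(hh_comm Q).
    have := qcommMr (uE b i) hjh; rewrite mulr1 /qcomm /u' -scalerAr -scalerAl => ->.
    by rewrite !scalerA mulrC.
  have /eqP := IH _ us uE' E a as_; rewrite scaler_eq0 subr_eq0 => /orP[/eqP|/eqP uh].
    by move/(exprz_inj_q q0 q_nroot) => H; rewrite H eqxx in aj.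
  by rewrite -[u a]mulr1 -(qw_hV Q j) mulrA uh mul0r.
move=> a; rewrite inE => /orP[/eqP ->|/tl //].
by move: sum0; rewrite big_cons big1_seq ?addr0 // => b /andP[_ /tl].
Qed.

Lemma vcomp_direct (s : seq 'rV[int]_n) (u : 'rV[int]_n -> B) : uniq s ->
  (forall a, vcomp a (u a)) -> \sum_(a <- s) u a = 0 -> forall a, a \in s -> u a = 0.
Proof.
move=> us uC; apply: eigen_direct => // a j.
by have := vcomp_hm (unitv j) (uC a); rewrite dot_unitvl monom_unitv.
Qed.

(** In an arbitrary algebra with these relations this is the subalgebra generated by [h], [hi], [x],
    [y]; for the tensor product it will be everything. *)
Definition graded := hsum vcomp.

Lemma graded_vcomp a t : vcomp a t -> graded t. Proof. exact: hsum_homog. Qed.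

Lemma graded_inR p : inR p -> graded p. Proof. by move/vcomp_weight0; exact: graded_vcomp. Qed.

Lemma graded_va a : graded (va a).
Proof. by apply: (@graded_vcomp a); exists 1; rewrite ?mul1r //; exact: inR1. Qed.

Lemma gradedM t t' : graded t -> graded t' -> graded (t * t').
Proof. exact: (hsumM vcomp_0 vcompM). Qed.

Lemma graded_lin c t t' : graded t -> graded t' -> graded (c *: t + t').
Proof.
move=> Gt; apply: hsumD; rewrite -[t]mul1r scalerAl; apply: gradedM => //.
exact/graded_inR/inR_scalar.
Qed.

(** One factor x_j or y_j of [va a] meets its partner in [va (- a)]; their product is h_j - 1 or q
    h_j - 1, and moving it to the right end changes only the coefficient of h_j. *)
Lemma factor_lin p r a j : inR p -> inR r -> a 0 j != 0 -> exists u c,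
  [/\ inR u, c != 0 & (p * va a) * (r * va (- a)) = p * u * (c *: h j - 1)].
Proof.
move=> Rp Rr aj.
(* [z] is split off [va a], [z'] is its partner in [va (- a)], and [b] is the remaining exponent;
   writing [z] as [va v] lets [va_inR] move [r] past it. *)
have step (b v : 'rV[int]_n) (z z' : B) c : va v = z -> va a = va b * z ->
    va (- a) = z' * va (- b) -> z * z' = c *: h j - 1 -> c != 0 ->
    exists u c, [/\ inR u, c != 0 & (p * va a) * (r * va (- a)) = p * u * (c *: h j - 1)].
  move=> vE Ea Ea' zz c0; have [r1 [R1 E1 _]] := va_inR v Rr; have [r2 [R2 E2 _]] := va_inR b R1.
  have [w [Rw _ wE]] := va_mul b (- b); rewrite subrr monom0 mulr1 in wE.
  exists (r2 * w), (c * q ^ (- b 0 j)); split; [exact: inRM | by rewrite mulf_neq0 ?expfz_neq0 |].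
  rewrite Ea Ea' -vE in E1 *.
  transitivity (p * (r2 * (va b * (z * z') * va (- b)))).
    rewrite -vE -!mulrA; congr (_ * _).
    by rewrite [va v * (r * _)]mulrA E1 -!mulrA [va b * (r1 * _)]mulrA E2 -!mulrA.
  rewrite zz va_lin -!mulrA wE; congr (_ * (_ * _)).
  by apply: inR_comm => //; exact: inR_lin.
case: (ltrgtP (a 0 j) 0) aj => // aj _.
- have aj1 : (a + unitv j) 0 j <= 0 by rewrite addvE eqxx -ltzD1 ltrD2r.
  have aj2 : 0 <= (- (a + unitv j)) 0 j by rewrite mxE oppr_ge0.
  have [_ E1] := va_y_pred Q aj1; have [cx E2] := va_x_succ Q aj2.
  rewrite addrK in E1; rewrite opprD addrNK -opprD in E2.
  apply: (step (a + unitv j) (- unitv j) (y j) (x j) q) => //; last exact: (qw_yx Q).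
    exact: monom_unitvN.
  by rewrite E2 cx.
- have aj1 : 0 <= (a - unitv j) 0 j by rewrite subvE eqxx subr_ge0.
  have aj2 : (- (a - unitv j)) 0 j <= 0 by rewrite mxE oppr_le0.
  have [_ E1] := va_x_succ Q aj1; have [cy E2] := va_y_pred Q aj2.
  rewrite subrK in E1; rewrite opprB addrAC subrr add0r -[unitv j - a]opprB in E2.
  apply: (step (a - unitv j) (unitv j) (x j) (y j) 1) => //.
  - exact: monom_unitv.
  - by rewrite E2 cy.
  - by rewrite scale1r; exact: (qw_xy Q).
  - exact: oner_neq0.
Qed.

End QweylGrading.

(** * Endomorphisms *)

Section QweylRigidity.
Variables (K : fieldType) (q : K).
Hypothesis q0 : q != 0.
Hypothesis q_nroot : forall m : nat, (0 < m)%N -> q ^+ m != 1.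
Variables (B : algType K) (n : nat) (h hi x y : 'I_n -> B).
Hypothesis Q : qweyl q h hi x y.
Local Notation hm := (monom h hi).
Local Notation va := (monom x y).
Local Notation inR := (inR h hi).
Local Notation vcomp := (vcomp h hi x y).
Local Notation graded := (graded h hi x y).
Local Notation inRM := (inRM Q).
Local Notation inRN := (inRN Q).
Local Notation inRZ := (inRZ Q).
Local Notation inR_lin := (inR_lin Q).
Implicit Types (m a b : 'rV[int]_n) (p r t u : B).

Lemma lin_mul_scalar u k j s : k != 0 -> inR u -> u * (k *: h j - 1) = s *: 1 -> u = 0.
Proof.
move=> k0 Ru E; have [s0|s0] := eqVneq s 0.
  apply/eqP/negPn/negP => u0; have := inR_domain q0 q_nroot Q Ru (inR_lin k j) u0.
  by rewrite E s0 scale0r eqxx => /(_ (lin_neq0 q0 q_nroot Q j k0)).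
case: (lin_nunit q0 q_nroot Q (r := s^-1 *: u) (j := j) k0).
  exact: inRZ.
by rewrite -scalerAl E scalerA mulVf // scale1r.
Qed.

(* If M l <> 0, conjugating by x l and subtracting would make k h_j - 1 divide a unit. *)
Lemma lin_dvd_support u k j c (M : 'rV[int]_n) l : k != 0 -> inR u -> c != 0 ->
  u * (k *: h j - 1) = c *: hm M - 1 -> l != j -> M 0 l = 0.
Proof.
move=> k0 Ru c0 E lj.
have [u' [Ru' uE _]] := va_inR q0 q_nroot Q (unitv l) Ru; rewrite monom_unitv in uE.
have xh : GRing.comm (x l) (k *: h j - 1).
  apply: commrD; last exact/commrN/commr1.
  by apply: commr_scale; apply/commr_sym/(qw_hxC Q); rewrite eq_sym.
have xM : x l * hm M = q ^ (- M 0 l) *: (hm M * x l).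
  by rewrite (hm_x q0 Q M l) scalerA -expfzDr // addNr expr0z scale1r.
(* The two sides agree after multiplication by x_l on the right, which [inR_va_reg] cancels. *)
have E' : u' * (k *: h j - 1) = (c * q ^ (- M 0 l)) *: hm M - 1.
  apply/subr0_eq/(inR_va_reg q0 q_nroot Q (a := unitv l)).
    apply: inRD; first by apply: inRM; [|apply: inR_lin].
    apply/inRN => //; apply: inRD; [exact: inR_hm | exact/inRN/inR1].
  rewrite monom_unitv mulrBl -mulrA -xh mulrA -uE -mulrA E mulrBr mulrBl -scalerAr xM scalerA.
  by rewrite scalerAl mulr1 mul1r subrr.
apply/eqP/negPn/negP => M0.
have D : (u - u') * (k *: h j - 1) = (c * (1 - q ^ (- M 0 l))) *: hm M.
  rewrite mulrBl E E' opprB addrA subrK -scalerBl.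
  by congr (_ *: _); rewrite mulrBr mulr1.
have d0 : c * (1 - q ^ (- M 0 l)) != 0.
  rewrite mulf_neq0 // subr_eq0 -(expr0z q); apply: contraNneq M0 => /(exprz_inj_q q0 q_nroot) /eqP.
  by rewrite eq_sym oppr_eq0.
case: (lin_nunit q0 q_nroot Q (r := ((c * (1 - q ^ (- M 0 l)))^-1 *: hm (- M)) * (u - u')) (j := j) k0).
  apply: inRM => //; first exact: inR_hm.
  by apply: inRD => //; exact: inRN.
by rewrite -mulrA D -scalerAl -scalerAr scalerA mulVf // scale1r (hmKN Q).
Qed.

(** The expected quotient is c/k for e = 1 and -c h_j^-1 for e = -1. Its difference from [u], times
    k h_j - 1, is a scalar, so [lin_mul_scalar] makes that difference 0. *)
Lemma lin_dvd_unit u k j c (e : int) : k != 0 -> inR u -> c != 0 -> `|e| = 1 ->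
  u * (k *: h j - 1) = c *: hm (e *: unitv j) - 1 -> exists2 v, inR v & u * v = 1.
Proof.
move=> k0 Ru c0 e1 E.
have [eE|eE] : e = 1 \/ e = -1 by case: (intP e) e1 => // -[|m] // _; [left|right].
- rewrite eE scale1r monom_unitv in E.
  have H : (u - (c / k) *: 1) * (k *: h j - 1) = (c / k - 1) *: 1.
    rewrite mulrBl E -scalerAl mul1r scalerBr scalerA divfK // scalerBl scale1r.
    by rewrite opprB addrC addrA subrK.
  have Ru' : inR (u - (c / k) *: 1) by apply: inRD => //; apply/inRN => //; apply: inR_scalar.
  have /subr0_eq -> := lin_mul_scalar k0 Ru' H.
  exists ((c / k)^-1 *: 1); first exact: inR_scalar.
  by rewrite -scalerAl mul1r scalerA divff ?scale1r // mulf_neq0 ?invr_neq0.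
- rewrite eE scaleN1r monom_unitvN in E.
  have H : (u + c *: hi j) * (k *: h j - 1) = (c * k - 1) *: 1.
    rewrite mulrDl E -scalerAl mulrBr -scalerAr (qw_Vh Q) mulr1 scalerBr scalerA.
    by rewrite addrC addrA subrK scalerBl scale1r.
  have Ru' : inR (u + c *: hi j).
    by apply: inRD => //; rewrite -(monom_unitvN h hi); exact: inR_hm.
  have /eqP := lin_mul_scalar k0 Ru' H; rewrite addr_eq0 => /eqP ->.
  exists (- c^-1 *: h j); first exact/inRZ/inR_h.
  by rewrite mulNr -scalerAl -scalerAr scalerA mulrN scaleNr opprK mulfV // scale1r (qw_Vh Q).
Qed.

(** Each j in the support of [a] confines the support of [M] to j, so [dot M a] is the single
    product M_j a_j of integers and both are 1 or -1. Then [lin_dvd_unit] turns the cofactor of the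
    linear factor into a unit, and [p] divides that cofactor. *)
Lemma pair_monomial p r a c (M : 'rV[int]_n) : inR p -> inR r -> c != 0 ->
  `|dot M a| = 1 -> (p * va a) * (r * va (- a)) = c *: hm M - 1 ->
  exists j (e e' : int), [/\ `|e| = 1, `|e'| = 1, M = e *: unitv j, a = e' *: unitv j
    & exists d m, d != 0 /\ p = d *: hm m].
Proof.
move=> Rp Rr c0 Ma E.
have supp j : a 0 j != 0 -> forall l, l != j -> M 0 l = 0.
  move=> aj l lj; have [u [k [Ru k0 uE]]] := factor_lin q0 q_nroot Q Rp Rr aj.
  rewrite E in uE; apply: (lin_dvd_support k0 _ c0 (esym uE) lj).
  exact: inRM.
have [j aj] : exists j, a 0 j != 0.
  apply/existsP; apply: contraT; rewrite negb_exists => /forallP H.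
  have a0 : a = 0 by apply/rowP => i; rewrite mxE; apply/eqP/negPn/H.
  by move: Ma; rewrite a0 /dot big1 // => i _; rewrite mxE mulr0.
have dotE : dot M a = M 0 j * a 0 j.
  by rewrite /dot (bigD1 j) //= big1 ?addr0 // => l lj; rewrite (supp j) ?mul0r.
have [Mj aj1] : `|M 0 j| = 1 /\ `|a 0 j| = 1.
  move: Ma; rewrite dotE normrM -!abszE -PoszM => -[] /eqP.
  by rewrite muln_eq1 => /andP[/eqP -> /eqP ->].
have ME : M = (M 0 j) *: unitv j.
  apply/rowP => l; rewrite mxE unitvE; have [->|lj] := eqVneq l j; first by rewrite mulr1.
  by rewrite mulr0 (supp j).
have aE : a = (a 0 j) *: unitv j.
  apply/rowP => l; rewrite mxE unitvE; have [->|lj] := eqVneq l j; first by rewrite mulr1.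
  (* A second index in the support of [a] would force M_j = 0. *)
  rewrite mulr0; apply/eqP/negPn/negP => al; move: Mj; rewrite (supp l) // eq_sym //.
exists j, (M 0 j), (a 0 j); split=> //.
have [u [k [Ru k0 uE]]] := factor_lin q0 q_nroot Q Rp Rr aj.
rewrite E ME in uE; have [v Rv] := lin_dvd_unit k0 (inRM Rp Ru) c0 Mj (esym uE).
rewrite -mulrA => H; have [d [m [d0 -> _]]] := inR_unit q0 q_nroot Q Rp (inRM Ru Rv) H.
by exists d, m.
Qed.

(** By [graded_unit] the factors have opposite weights; a nonzero weight would give 1 a divisor k
    h_j - 1, so the weight is 0 and [inR_unit] applies. *)
Lemma graded_unit_monomial t t' : graded t -> graded t' -> t * t' = 1 ->
  exists c m, [/\ c != 0, t = c *: hm m & t' = c^-1 *: hm (- m)].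
Proof.
move=> Gt Gt' tt'.
have [||a Ca Ca'] := graded_unit (vcomp_0 h hi x y) (@vcompD _ _ _ h hi x y) (vcompN Q)
  (vcompM q0 q_nroot Q) (vcomp_direct q0 q_nroot Q) (vcomp_nz q0 q_nroot Q) (@lex_ordered n) Gt Gt';
  rewrite ?tt' ?oner_neq0 //.
  by apply/vcomp_weight0; exact: inR1.
have [p Rp pE] := Ca; have [r Rr rE] := Ca'.
have a0 : a = 0.
  apply/rowP => j; rewrite mxE; apply/eqP/negPn/negP => aj.
  have [u [k [Ru k0]]] := factor_lin q0 q_nroot Q Rp Rr aj.
  rewrite -pE -rE tt' => /esym; exact: (lin_nunit q0 q_nroot Q k0 (inRM Rp Ru)).
rewrite a0 ?oppr0 in Ca Ca'; apply: (inR_unit q0 q_nroot Q) => //; exact/(vcomp_weight0 h hi x y).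
Qed.

(** Components of the eigenvector equation are compared weight by weight. Nothing is assumed about
    the family [M]: that some weight exists in the support is what later shows [M] to be
    invertible. *)
Lemma graded_eigen_support (I : Type) (M : I -> 'rV[int]_n) (d : I -> int) t :
  graded t -> t != 0 -> (forall k, qcomm (q ^ d k) (hm (M k)) t) ->
  exists s (u : 'rV[int]_n -> B), [/\ uniq s, s != [::], forall b, vcomp b (u b),
    forall b k, b \in s -> dot (M k) b = d k & t = \sum_(b <- s) u b].
Proof.
move=> Gt nz tE.
have [s [u [us uC unz E]]] := hsum_normal (vcomp_0 h hi x y) (@vcompD _ _ _ h hi x y) Gt.
exists s, u; split=> // [|b k].
  by apply: contraNneq nz => s0; rewrite E s0 big_nil.
move=> bs; pose u' b := (q ^ (dot (M k) b) - q ^ d k) *: (u b * hm (M k)).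
have u'C b' : vcomp b' (u' b').
  have [p Rp pE] := uC b'; exists ((q ^ (dot (M k) b') - q ^ d k) * q ^ (- dot (M k) b') *: (hm (M k) * p)).
    by apply: inRZ => //; apply: inRM => //; rewrite -[hm _]scale1r; exact: inR_hm.
  rewrite /u' -scalerA -!scalerAl; congr (_ *: _).
  rewrite -mulrA -pE (vcomp_hm q0 Q (M k) (uC b')) scalerA -expfzDr // addNr expr0z scale1r //.
have sum0 : \sum_(b <- s) u' b = 0.
  have := tE k; rewrite /qcomm E big_distrl big_distrr /= scaler_sumr => /eqP.
  rewrite -subr_eq0 -sumrB => /eqP E0; rewrite -[RHS]E0; apply: eq_bigr => c _.
  by rewrite (vcomp_hm q0 Q (M k) (uC c)) -scalerBl.
have /eqP := vcomp_direct q0 q_nroot Q us u'C sum0 bs.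
rewrite scaler_eq0 subr_eq0 => /orP[/eqP /(exprz_inj_q q0 q_nroot) //|/eqP H].
have := unz _ bs; rewrite -[u b]mulr1 -(hmNK Q (M k)) mulrA H mul0r eqxx //.
Qed.

Lemma graded_eigen (I : Type) (M : I -> 'rV[int]_n) (d : I -> int) t :
  (forall b b', (forall k, dot (M k) b = dot (M k) b') -> b = b') ->
  graded t -> t != 0 -> (forall k, qcomm (q ^ d k) (hm (M k)) t) ->
  exists2 b, vcomp b t & forall k, dot (M k) b = d k.
Proof.
move=> Minj Gt nz /(graded_eigen_support Gt nz) [s [u [us s0 uC dE ->]]].
case: s us s0 dE => [|b [|b' s]] // us _ dE.
- by exists b => [|k]; [rewrite big_seq1 | apply: dE; rewrite mem_head].
- suff bb' : b = b' by move: us; rewrite /= bb' mem_head.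
  by apply: Minj => k; rewrite !dE // !inE eqxx ?orbT.
Qed.

End QweylRigidity.

Lemma qweyl_hom (K : fieldType) (q : K) (A B : algType K) (f : A -> B) n
    (h hi x y : 'I_n -> A) :
  is_alg_hom f -> qweyl q h hi x y -> qweyl q (f \o h) (f \o hi) (f \o x) (f \o y).
Proof.
move=> fP Q.
have comm u v : GRing.comm u v -> GRing.comm (f u) (f v).
  by move=> uv; rewrite /GRing.comm -!(alg_homM fP) uv.
split=> [i|i|i|i|i|i|i j ij|i j ij|i j ij|i j ij|i j ij|i j ij] /=; last first.
- exact/comm/(qw_yyC Q).
- exact/comm/(qw_xyC Q).
- exact/comm/(qw_xxC Q).
- exact/comm/(qw_hyC Q).
- exact/comm/(qw_hxC Q).
- exact/comm/(qw_hh Q).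
- by rewrite -(alg_homM fP) (qw_yx Q) (alg_homB fP) (alg_homZ fP) (alg_hom1 fP).
- by rewrite -(alg_homM fP) (qw_xy Q) (alg_homB fP) (alg_hom1 fP).
- by rewrite -!(alg_homM fP) (qw_yh Q) (alg_homZ fP).
- by rewrite -!(alg_homM fP) (qw_hx Q) (alg_homZ fP).
- by rewrite -(alg_homM fP) (qw_Vh Q) (alg_hom1 fP).
- by rewrite -(alg_homM fP) (qw_hV Q) (alg_hom1 fP).
Qed.

Lemma alg_hom_monom (K : fieldType) (A B : algType K) (f : A -> B) n (u v : 'I_n -> A) m :
  is_alg_hom f -> f (monom u v m) = monom (f \o u) (f \o v) m.
Proof.
move=> fP; rewrite /monom (alg_hom_prod fP); apply: eq_bigr => j _.
by case: (m 0 j) => k; apply: alg_homX.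
Qed.

Section Endomorphism.
Variables (K : fieldType) (q : K).
Hypothesis q0 : q != 0.
Hypothesis q_nroot : forall m : nat, (0 < m)%N -> q ^+ m != 1.

(** The images satisfy the same relations, so the independence of monomials and the directness of
    weight spaces hold for them in [B]; all coefficients of [t] can be read off from [f t]. *)
Lemma graded_alg_hom_inj (A B : algType K) (f : A -> B) n (h hi x y : 'I_n -> A) t :
  is_alg_hom f -> qweyl q h hi x y -> graded h hi x y t -> f t = 0 -> t = 0.
Proof.
move=> fP Q Gt; have Q' := qweyl_hom fP Q.
have fR p : inR h hi p -> inR (f \o h) (f \o hi) (f p) /\ (f p = 0 -> p = 0).
  move=> Rp; have [s [u [us /choice [c cE] _ pE]]] := hsum_normal (hcomp_0 h hi) (@hcompD _ _ _ h hi) Rp.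
  have fpE : f p = \sum_(m <- s) c m *: monom (f \o h) (f \o hi) m.
    rewrite pE (alg_hom_sum fP); apply: eq_bigr => m _.
    by rewrite cE (alg_homZ fP) alg_hom_monom.
  split=> [|fp0].
    by rewrite fpE; apply: hsum_sum => [m|m]; [exact: hcomp_0 | exact: inR_hm].
  rewrite pE big1_seq // => m /andP[_ ms].
  rewrite cE (hm_va_indep q0 q_nroot Q' (a := 0) us _ ms) ?scale0r //.
  by rewrite -[RHS]fp0 fpE; apply: eq_bigr => k _; rewrite monom0 mulr1.
have [s [u [us uC _ tE]]] := hsum_normal (vcomp_0 h hi x y) (@vcompD _ _ _ h hi x y) Gt.
have fuC a : vcomp (f \o h) (f \o hi) (f \o x) (f \o y) a (f (u a)).
  have [p Rp ->] := uC a; exists (f p); first by case: (fR p Rp).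
  by rewrite (alg_homM fP) alg_hom_monom.
rewrite tE (alg_hom_sum fP) => sum0.
rewrite big1_seq // => a /andP[_ as_].
have := vcomp_direct q0 q_nroot Q' us fuC sum0 as_.
have [p Rp ->] := uC a; have [Rfp fp0] := fR p Rp.
rewrite (alg_homM fP) (alg_hom_monom _ _ _ fP) => /(inR_va_reg q0 q_nroot Q' Rfp) /fp0 ->.
by rewrite mul0r.
Qed.

Variables (B : algType K) (n : nat) (h hi x y H Hi X Y : 'I_n -> B).
Hypothesis Q : qweyl q h hi x y.
Hypothesis QH : qweyl q H Hi X Y.
Hypothesis graded_all : forall t, graded h hi x y t.
Local Notation hm := (monom h hi).
Local Notation va := (monom x y).

(** H_i - 1 and q H_i - 1 cannot both vanish, because q is not 1. *)
Lemma qweyl_xy_neq0 i : X i != 0 /\ Y i != 0.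
Proof.
suff XY : X i * Y i != 0 \/ Y i * X i != 0.
  by split; apply/eqP => E; case: XY; rewrite E ?mul0r ?mulr0 eqxx.
rewrite (qw_xy QH) (qw_yx QH) !subr_eq0; have [H1|] := eqVneq (H i) 1; last by left.
right; rewrite H1 -subr_eq0 -[X in _ - X]scale1r -scalerBl scaler_eq0 oner_eq0 orbF.
by rewrite subr_eq0; exact: (q_nroot (m := 1)).
Qed.

(* If M is the matrix of exponents of the units H i, the weight a of X i satisfies
   M a = (i-th unit vector), so M is invertible and a is unique; then X i * Y i = H i - 1
   forces M and its inverse to be signed permutation matrices. *)
Lemma endo_monomial : exists (c : 'I_n -> K) (M : 'I_n -> 'rV[int]_n),
  [/\ forall i, [/\ c i != 0, H i = c i *: hm (M i) & Hi i = (c i)^-1 *: hm (- M i)],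
    forall j, exists i, M i 0 j != 0
  & forall i, exists j (e e' : int), [/\ `|e| = 1, `|e'| = 1, M i = e *: unitv j &
      exists d m d' m', [/\ d != 0, d' != 0, X i = d *: (hm m * va (e' *: unitv j))
        & Y i = d' *: (hm m' * va (- (e' *: unitv j)))]]].
Proof.
have Hmono i : exists cm : K * 'rV[int]_n,
    [/\ cm.1 != 0, H i = cm.1 *: hm cm.2 & Hi i = cm.1^-1 *: hm (- cm.2)].
  have [c [m [c0 E E']]] := graded_unit_monomial q0 q_nroot Q (graded_all _) (graded_all _) (qw_hV QH i).
  by exists (c, m).
have [cm cmP] := choice Hmono; pose c i := (cm i).1; pose M i := (cm i).2.
have c0 i : c i != 0 by case: (cmP i).
have HE i : H i = c i *: hm (M i) by case: (cmP i).
have hmE i : hm (M i) = (c i)^-1 *: H i by rewrite HE scalerA mulVf // scale1r.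
have X_eigen i k : qcomm (q ^ (k == i)%:Z) (hm (M k)) (X i).
  rewrite hmE /qcomm -scalerAl -scalerAr; have [->|ki] := eqVneq k i.
    by rewrite (qw_hx QH) expr1z !scalerA mulrC.
  by rewrite (qw_hxC QH ki) expr0z scale1r.
have Y_eigen i k : qcomm (q ^ (- (k == i)%:Z)) (hm (M k)) (Y i).
  rewrite hmE /qcomm -scalerAl -scalerAr; have [->|ki] := eqVneq k i.
    by rewrite (qw_yh QH) !scalerA mulrAC -[q ^ _]/(q^-1) mulVf // mul1r.
  by rewrite (qw_hyC QH ki) oppr0 expr0z scale1r.
have ex_a i : exists a, forall k, dot (M k) a = (k == i)%:Z.
  have [s [u [_ s0 _ dE _]]] := graded_eigen_support q0 q_nroot Q (graded_all _)
    (proj1 (qweyl_xy_neq0 i)) (X_eigen i).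
  case: s s0 dE => // b s _ dE; exists b => k; apply: dE; exact: mem_head.
have [a0 a0E] := choice ex_a.
(* The rows of [Mx] are the exponents, the columns of [Ax] the weights found above. [Mx *m Ax] is
   the identity, and for square matrices over a commutative ring so is the reverse product. *)
pose Mx : 'M[int]_n := \matrix_(k, j) M k 0 j.
pose Ax : 'M[int]_n := \matrix_(j, i) a0 i 0 j.
have AM : Ax *m Mx = 1%:M.
  apply: mulmx1C; apply/matrixP => k i; rewrite !mxE [RHS]natz -(a0E i k).
  by apply: eq_bigr => j _; rewrite !mxE.
have Minj b b' : (forall k, dot (M k) b = dot (M k) b') -> b = b'.
  move=> bb'; apply: trmx_inj; rewrite -[b^T]mul1mx -[b'^T]mul1mx -AM -!mulmxA; congr (_ *m _).
  apply/colP => k; rewrite !mxE; have := bb' k; rewrite /dot.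
  by move=> E; transitivity (\sum_j M k 0 j * b 0 j); [|rewrite E]; apply: eq_bigr => j _; rewrite !mxE.
exists c, M; split=> // [j|i].
  (* A zero j-th column of [Mx] would make the j-th diagonal entry of [Ax *m Mx] zero. *)
  apply/existsP; apply: contraT; rewrite negb_exists => /forallP M0.
  move/matrixP: AM => /(_ j j); rewrite !mxE eqxx big1 // => i _.
  by have /negPn/eqP Mi := M0 i; rewrite !mxE Mi mulr0.
have [X0 Y0] := qweyl_xy_neq0 i.
have [a [p Rp pE] aE] := graded_eigen q0 q_nroot Q Minj (graded_all _) X0 (X_eigen i).
have [b [r Rr rE] bE] := graded_eigen q0 q_nroot Q Minj (graded_all _) Y0 (Y_eigen i).
have ab : b = - a by apply: Minj => k; rewrite bE dotNr aE.
rewrite ab in rE.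
have E1 : (p * va a) * (r * va (- a)) = c i *: hm (M i) - 1.
  by rewrite -pE -rE (qw_xy QH) HE.
(* The product in the other order, q H_i - 1, has the same form and shows that [r] is a monomial as
   well. *)
have E2 : (r * va (- a)) * (p * va (- - a)) = (q * c i) *: hm (M i) - 1.
  by rewrite opprK -pE -rE (qw_yx QH) HE scalerA.
have Ma1 : `|dot (M i) a| = 1 by rewrite aE eqxx.
have Ma2 : `|dot (M i) (- a)| = 1 by rewrite dotNr normrN.
have [j [e [e' [e1 e1' ME aE' [d [m [d0 dE]]]]]]] := pair_monomial q0 q_nroot Q Rp Rr (c0 i) Ma1 E1.
have [_ [_ [_ [_ _ _ _ [d' [m' [d0' dE']]]]]]] :=
  pair_monomial q0 q_nroot Q Rr Rp (mulf_neq0 q0 (c0 i)) Ma2 E2.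
exists j, e, e'; split=> //; exists d, m, d', m'; split=> //.
- by rewrite pE dE aE' scalerAl.
- by rewrite rE dE' aE' scalerAl.
Qed.

(** [P] will be the image of the homomorphism. It contains h_j and its inverse, being multiples of
    some H_i and Hi_i, hence every [hm m]; stripping these units from X_i and Y_i leaves x_j and
    y_j, exchanged when the sign [e'] is -1. *)
Lemma endo_generates (P : B -> Prop) :
  P 1 -> (forall c u v, P u -> P v -> P (c *: u + v)) -> (forall u v, P u -> P v -> P (u * v)) ->
  (forall i, [/\ P (H i), P (Hi i), P (X i) & P (Y i)]) ->
  forall i, [/\ P (hi i), P (x i) & P (y i)].
Proof.
move=> P1 Plin PM PH.
have P0 : P 0 by have := Plin (-1) _ _ P1 P1; rewrite scaleN1r addNr.
have PZ c u : P u -> P (c *: u) by move=> Pu; have := Plin c _ _ Pu P0; rewrite addr0.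
have PZ' c u : c != 0 -> P (c *: u) -> P u.
  by move=> c0 /(PZ c^-1); rewrite scalerA mulVf // scale1r.
have PX u k : P u -> P (u ^+ k).
  by move=> Pu; elim: k => [|k IH]; rewrite ?expr0 // exprS; apply: PM.
have [c [M [HE Mj XE]]] := endo_monomial.
have unit_eq (e : int) : `|e| = 1 -> e = 1 \/ e = -1.
  by case: (intP e) => // -[|m] // _; [left|right].
(* Every j is reached: an [M i] with nonzero j-th entry is a signed unit vector, necessarily at
   j. *)
have pick j : exists i, exists e e' : int, [/\ `|e| = 1, `|e'| = 1, M i = e *: unitv j &
      exists d m d' m', [/\ d != 0, d' != 0, X i = d *: (hm m * va (e' *: unitv j))
        & Y i = d' *: (hm m' * va (- (e' *: unitv j)))]].
  have [i Mij] := Mj j; exists i; have [j' [e [e' [e1 e1' ME EX]]]] := XE i.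
  suff jj' : j = j' by exists e, e'; rewrite jj'.
  by apply/eqP; move: Mij; apply: contraR => jj'; rewrite ME mxE unitvE (negPf jj') mulr0.
have Ph j : P (h j) /\ P (hi j).
  have [i [e [e' [/unit_eq e1 _ ME _]]]] := pick j.
  have [c0 HiE HiE'] := HE i; have [PHi PHi' _ _] := PH i.
  move: PHi PHi'; rewrite HiE HiE' ME => /(PZ' _ _ c0) Pa /PZ' Pb.
  have := Pb (invr_neq0 c0); move: Pa.
  by case: e1 => ->; rewrite ?scaleN1r ?scale1r ?opprK monom_unitv monom_unitvN.
have Phm m : P (hm m).
  apply: (big_ind P) => // j _; have [Pj Pj'] := Ph j.
  by case: (m 0 j) => k; apply: PX.
have Pdiv d m u : d != 0 -> P (d *: (hm m * u)) -> P u.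
  by move=> d0 /(PZ' _ _ d0) /(PM _ _ (Phm (- m))); rewrite mulrA (hmKN Q) mul1r.
move=> j; split; first by case: (Ph j).
- have [i [_ [e' [_ /unit_eq e1 _ [d [m [d' [m' [d0 d0' EX EY]]]]]]]]] := pick j.
  have [_ _ PXi PYi] := PH i; rewrite EX in PXi; rewrite EY in PYi.
  case: e1 => e1; rewrite e1 ?scaleN1r ?scale1r ?opprK ?monom_unitv ?monom_unitvN in PXi PYi.
  + exact: Pdiv PXi.
  + exact: Pdiv PYi.
- have [i [_ [e' [_ /unit_eq e1 _ [d [m [d' [m' [d0 d0' EX EY]]]]]]]]] := pick j.
  have [_ _ PXi PYi] := PH i; rewrite EX in PXi; rewrite EY in PYi.
  case: e1 => e1; rewrite e1 ?scaleN1r ?scale1r ?opprK ?monom_unitv ?monom_unitvN in PXi PYi.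
  + exact: Pdiv PYi.
  + exact: Pdiv PXi.
Qed.

End Endomorphism.

(** * Return to the tensor products *)

Lemma tensorA_graded (K : fieldType) (q : K) n (alpha : 'I_n -> K) (T : algType K)
    (e1 e2 e3 h hi x : 'I_n -> T) (k l : 'I_n -> K) :
  q != 0 -> (forall m : nat, (0 < m)%N -> q ^+ m != 1) ->
  is_tensorA alpha q e1 e2 e3 -> qweyl q h hi x e2 ->
  (forall i, e1 i = k i *: (hi i * x i ^+ 2)) -> (forall i, e3 i = l i *: x i) ->
  forall t, graded h hi x e2 t.
Proof.
move=> q0 q_nroot TP Q e1E e3E.
have G1 : graded h hi x e2 1 by apply/graded_inR/inR1.
have G0 : graded h hi x e2 0 by apply/graded_inR/inR0.
have GZ c u : graded h hi x e2 u -> graded h hi x e2 (c *: u).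
  by move=> Gu; rewrite -[_ *: _]addr0; exact: (graded_lin q0 q_nroot Q).
have Gx i : graded h hi x e2 (x i) by rewrite -(monom_unitv x e2); exact: graded_va.
have Gy i : graded h hi x e2 (e2 i) by rewrite -(monom_unitvN x e2); exact: graded_va.
have Ghi i : graded h hi x e2 (hi i).
  by apply: graded_inR; rewrite -(monom_unitvN h hi) -[monom _ _ _]scale1r; exact: inR_hm.
apply: (tensorA_ind TP) => // [c u v Gu Gv|u v Gu Gv|i].
- exact: (graded_lin q0 q_nroot Q).
- exact: (gradedM q0 q_nroot Q).
- split=> //; last by rewrite e3E; apply: GZ.
  rewrite e1E; apply: GZ; apply: (gradedM q0 q_nroot Q) => //.
  exact: (gradedM q0 q_nroot Q).
Qed.

Theorem theorem1p3 (K : fieldType) (q : K) (n : nat)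
    (alpha alpha' : 'I_n -> K)
    (T : algType K) (e1 e2 e3 : 'I_n -> T)
    (T' : algType K) (e1' e2' e3' : 'I_n -> T') :
  q != 0 ->
  (forall m : nat, (0 < m)%N -> q ^+ m != 1) ->
  (1 <= n)%N ->
  (forall i, alpha i != 0) ->
  (forall i, alpha' i != 0) ->
  is_tensorA alpha q e1 e2 e3 ->
  is_tensorA alpha' q e1' e2' e3' ->
  forall f : T -> T', is_alg_hom f -> bijective f.
Proof.
move=> q0 q_nroot _ a0 a0' TP TP' f fP.
have q1 : q != 1 by exact: (q_nroot 1).
have qq1 : q ^+ 2 != 1 by exact: q_nroot.
have [h [hi [x [k [l [Q e1E e3E]]]]]] := tensorA_qweyl q0 q1 qq1 a0 (proj1 TP).
have [h' [hi' [x' [k' [l' [Q' e1E' e3E']]]]]] := tensorA_qweyl q0 q1 qq1 a0' (proj1 TP').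
have G := tensorA_graded q0 q_nroot TP Q e1E e3E.
have G' := tensorA_graded q0 q_nroot TP' Q' e1E' e3E'.
have f_inj : injective f.
  move=> u v uv; apply/subr0_eq/(graded_alg_hom_inj q0 q_nroot fP Q (G _)).
  by rewrite (alg_homB fP) uv subrr.
pose P t := exists u, f u = t.
have P1 : P 1 by exists 1; exact: alg_hom1 fP.
have Plin c t t' : P t -> P t' -> P (c *: t + t').
  by move=> [u <-] [v <-]; exists (c *: u + v); case: fP.
have PM t t' : P t -> P t' -> P (t * t').
  by move=> [u <-] [v <-]; exists (u * v); case: fP.
have P0 : P 0 by exists 0; exact: alg_hom0.
have PZ c t : P t -> P (c *: t) by move=> Pt; rewrite -[_ *: _]addr0; apply: Plin.
(* Applied inside [T'] to the images of the elements of [T]: in Weyl form both sides satisfy the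
   same relations, since the parameters [alpha] and [alpha'] have disappeared. *)
have gen := endo_generates q0 q_nroot Q' (qweyl_hom fP Q) G' P1 Plin PM.
have f_surj : forall t, P t.
  apply: (tensorA_ind TP') => // i.
  have [|Phi Px Py] := gen _ i.
    by move=> j; split; eexists.
  by split=> //; [rewrite e1E'; apply: PZ; exact: PM _ _ Phi (PM _ _ Px Px) | rewrite e3E'; apply: PZ].
have [g gE] := choice f_surj.
by exists g => t //; apply: f_inj.
Qed.
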